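(* Let $f_1,\dots,f_m$ and $\mathcal G$ satisfy the standing assumptions in the context with $\mu=0$ (convex case). Let $\{(\mathbf X^k,\mathbf D^k)\}_{k\ge0}$ be generated by the algorithm ADOLF described in the context with $c_1\in(0,1)$ and $c_2\in(0,1]$, where $\{\sigma^k\}_{k\ge0}$ is monotonically nondecreasing with $0<\sigma^k\le\overline\sigma$ for some $0<\overline\sigma<\infty$ and all $k\ge0$, and $\pi^k:\mathbb R\to\mathbb R$ satisfies $\pi^k(x)\ge x$ for all $x\ge0$ and all $k$. Let $\{\mathbf Y^k\}_{k\ge0}$ be the auxiliary sequence with $\mathbf Y^0=\mathbf 0$ and $\mathbf Y^{k+1}=\mathbf Y^k+\sigma^k\alpha^k\big((1+\gamma^k)\mathbf L\mathbf X^k-\gamma^k\mathbf L\mathbf X^{k-1}\big)$, $k\ge0$, with $\mathbf L:=(I-W)^{1/2}$. Then: (a) There is a saddle point $(\mathbf X^\star,\mathbf Y^\star)$ of $\mathcal L(\mathbf X,\mathbf Y)=F(\mathbf X)+\langle\mathbf L\mathbf X,\mathbf Y\rangle$ such that $\mathbf X^k\to\mathbf X^\star$, $\mathbf Y^k\to\mathbf Y^\star$ and $\mathbf D^k\to\mathbf L\mathbf Y^\star$. (b) If moreover $c_2\in(0,1)$, then, with $\overline{\mathbf X}^k:=\frac1{\theta^k}\sum_{t=0}^{k-1}\gamma^t\mathbf X^t$, $\theta^k:=\sum_{t=0}^{k-1}\gamma^t$ ($k\ge1$), and $$\mathcal M_\star(\mathbf X):=F(\mathbf X)-F(\mathbf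 X^\star)+\langle\mathbf L\mathbf Y^\star,\mathbf X-\mathbf X^\star\rangle+\|\mathbf L\mathbf X\|^2,$$ one has $\mathcal M_\star(\overline{\mathbf X}^k)\le\varepsilon$ for all $k\ge N_\varepsilon$ with $N_\varepsilon=\mathcal O(\widetilde L/\varepsilon)$; that is, there is a constant $C>0$, independent of $\varepsilon$ and $k$, such that for every $\varepsilon>0$, $\mathcal M_\star(\overline{\mathbf X}^k)\le\varepsilon$ for all integers $k\ge1$ with $k\ge C\widetilde L/\varepsilon$. Here $\widetilde L>0$ is the Lipschitz constant of $\nabla F$ restricted to the convex hull of $\bigcup_{t=0}^\infty[\mathbf X^{t-1},\mathbf X^t]$ ($[\mathbf A,\mathbf B]$ denotes the segment between $\mathbf A$ and $\mathbf B$).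
   Context: There are $m$ agents. Each $f_i:\mathbb R^d\to\mathbb R$ ($i=1,\dots,m$) is continuously differentiable, locally smooth (its gradient is locally Lipschitz), and $\mu$-strongly convex with $\mu\in[0,\infty)$ ($\mu=0$ means merely convex); if $\mu=0$, $f=\frac1m\sum_i f_i$ has a minimizer over $\mathbb R^d$. For $\mathbf X=[x_1,\dots,x_m]^\top\in\mathbb R^{m\times d}$, $F(\mathbf X):=\sum_{i=1}^m f_i(x_i)$, and $\nabla F(\mathbf X)$ is the $m\times d$ matrix with rows $\nabla f_i(x_i)^\top$. $\|\cdot\|$ and $\langle\cdot,\cdot\rangle$ on matrices are the Frobenius norm and inner product. $\mathcal G=(\mathcal V,\mathcal E)$, $\mathcal V=\{1,\dots,m\}$, is an undirected connected graph. $\mathcal W_{\mathcal G}$ is the set of symmetric doubly stochastic matrices $\widetilde W=(\widetilde w_{ij})$ with $\widetilde w_{ii}>0$ for all $i$, $\widetilde w_{ij}>0$ for $(i,j)\in\mathcal E$, and $\widetilde w_{ij}=0$ otherwise. A saddle point $(\mathbf X^*,\mathbf Y^* )$ of $\mathcal L$ satisfies $\mathcal L(\mathbf X^*,\mathbf Y)\le\mathcal L(\mathbf X^*,\mathbf Y^* )\le\mathcal L(\mathbf X,\mathbf Y^* )$ for all $\mathbf X,\mathbf Y\in\mathbb R^{m\times d}$. Algorithm ADOLF. Data: $\mathbf X^{-1},\mathbf X^0\in\mathbb R^{m\times d}$, $\mathbf D^0=\mathbf 0$, $\alpha^0>0$, $\sigma^k>0$ for $k\ge0$, $c_1,c_2\in(0,1]$,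 $\gamma^0=1$, functions $\pi^k:\mathbb R\to\mathbb R$, and $W=(1-c)I+c\widetilde W$ with $c\in(0,1/2)$, $\widetilde W\in\mathcal W_{\mathcal G}$. For $k\ge1$, given $\mathbf X^k,\mathbf X^{k-1}$, compute $$L^k=\frac{\|\nabla F(\mathbf X^k)-\nabla F(\mathbf X^{k-1})\|}{\|\mathbf X^k-\mathbf X^{k-1}\|}\quad(L^k:=0\text{ if }\mathbf X^k=\mathbf X^{k-1}),$$ $$\alpha^k=\min\Big\{\frac1{\sqrt{(L^k)^2+2\sigma^k/c_1}+L^k},\ \sqrt{1+c_2\gamma^{k-1}}\,\alpha^{k-1},\ \pi^k(\alpha^{k-1})\Big\},\qquad\gamma^k=\alpha^k/\alpha^{k-1}.$$ For every $k\ge0$ (with the given $\alpha^0,\gamma^0$ when $k=0$) update $$\mathbf D^{k+1}=\mathbf D^k+\sigma^k\alpha^k(I-W)\big((1+\gamma^k)\mathbf X^k-\gamma^k\mathbf X^{k-1}\big),\qquad\mathbf X^{k+1}=\mathbf X^k-\alpha^k\big(\nabla F(\mathbf X^k)+\mathbf D^{k+1}\big).$$ *)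

(* Defs.v *)
From HB Require Import structures.
From mathcomp Require Import all_boot all_order all_algebra.
From mathcomp Require Import all_classical all_reals all_analysis.

Set Implicit Arguments.
Unset Strict Implicit.
Unset Printing Implicit Defensive.

Import Order.TTheory GRing.Theory Num.Theory.
Import numFieldNormedType.Exports.

Local Open Scope classical_set_scope.
Local Open Scope ring_scope.
Local Open Scope convex_scope.

(* The library norm `|A| on matrices is the max norm; it induces the same
   topology as the Frobenius norm, but the two differ quantitatively. *)
Definition frob_dot (R : realType) (p q : nat) (A B : 'M[R]_(p, q)) : R :=
  \sum_(i < p) \sum_(j < q) A i j * B i j.

Definition frob_norm (R : realType) (p q : nat) (A : 'M[R]_(p, q)) : R :=
  Num.sqrt (frob_dot A A).

Definition frob_lipschitz (R : realType) (p q r s : nat) (K : R)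
    (S : set 'M[R]_(p, q)) (g : 'M[R]_(p, q) -> 'M[R]_(r, s)) : Prop :=
  forall x y, S x -> S y ->
    frob_norm (g x - g y) <= K * frob_norm (x - y).

(* Points of R^d are row vectors, so that the i-th agent's variable is the i-th
   row of the stacked matrix X. *)
Definition grad (R : realType) (d : nat) (g : 'rV[R]_d -> R) (x : 'rV[R]_d) :
    'rV[R]_d :=
  \row_(j < d) 'D_(delta_mx 0 j) g x.

Definition continuously_differentiable (R : realType) (d : nat)
    (g : 'rV[R]_d -> R) : Prop :=
  (forall x, differentiable g x) /\ continuous (grad g).

Definition locally_smooth (R : realType) (d : nat) (g : 'rV[R]_d -> R) : Prop :=
  forall x : 'rV[R]_d, exists (U : set 'rV[R]_d) (K : R),
    nbhs x U /\ frob_lipschitz K U (grad g).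

Definition convex_on_space (R : realType) (d : nat) (g : 'rV[R]_d -> R) : Prop :=
  convex_function [set: convex_lmodType 'rV[R]_d] g.

Definition sumF (R : realType) (m d : nat) (f : 'I_m -> 'rV[R]_d -> R)
    (X : 'M[R]_(m, d)) : R :=
  \sum_(i < m) f i (row i X).

Definition gradF (R : realType) (m d : nat) (f : 'I_m -> 'rV[R]_d -> R)
    (X : 'M[R]_(m, d)) : 'M[R]_(m, d) :=
  \matrix_(i < m, j < d) grad (f i) (row i X) 0 j.

Definition avg_objective (R : realType) (m d : nat)
    (f : 'I_m -> 'rV[R]_d -> R) (x : 'rV[R]_d) : R :=
  m%:R^-1 * \sum_(i < m) f i x.

Definition undirected_connected (m : nat) (e : rel 'I_m) : Prop :=
  symmetric e /\ forall i j, connect e i j.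

Definition doubly_stochastic (R : realType) (m : nat) (A : 'M[R]_m) : Prop :=
  [/\ forall i j, 0 <= A i j,
      forall i, \sum_(j < m) A i j = 1
    & forall j, \sum_(i < m) A i j = 1].

Definition gossip_matrix (R : realType) (m : nat) (e : rel 'I_m)
    (A : 'M[R]_m) : Prop :=
  [/\ A^T = A, doubly_stochastic A,
      forall i, 0 < A i i,
      forall i j, e i j -> 0 < A i j
    & forall i j, i != j -> ~~ e i j -> A i j = 0].

(* B = A^(1/2): the unique symmetric positive semidefinite square root of A. *)
Definition is_psd_sqrt (R : realType) (m : nat) (A B : 'M[R]_m) : Prop :=
  [/\ B^T = B,
      forall v : 'cV[R]_m, 0 <= (v^T *m B *m v) 0 0
    & B *m B = A].

Definition lagrangian (R : realType) (m d : nat) (f : 'I_m -> 'rV[R]_d -> R)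
    (L : 'M[R]_m) (X Y : 'M[R]_(m, d)) : R :=
  sumF f X + frob_dot (L *m X) Y.

Definition saddle_point (R : realType) (p q : nat)
    (Lag : 'M[R]_(p, q) -> 'M[R]_(p, q) -> R) (Xs Ys : 'M[R]_(p, q)) : Prop :=
  forall X Y, Lag Xs Y <= Lag Xs Ys /\ Lag Xs Ys <= Lag X Ys.

(* Sequences indexed from -1 are encoded by their value xm1 at -1 and the
   sequence x of their values at 0, 1, ...; prev xm1 x k is the term at k - 1. *)
Definition prev (T : Type) (xm1 : T) (x : nat -> T) (k : nat) : T :=
  if k is j.+1 then x j else xm1.

Definition local_lip (R : realType) (m d : nat) (f : 'I_m -> 'rV[R]_d -> R)
    (X X' : 'M[R]_(m, d)) : R :=
  if X == X' then 0
  else frob_norm (gradF f X - gradF f X') / frob_norm (X - X').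

Definition stepsize (R : realType) (c1 c2 Lk sigmak gammap alphap : R)
    (pik : R -> R) : R :=
  Num.min (Num.sqrt (Lk ^+ 2 + 2 * sigmak / c1) + Lk)^-1
    (Num.min (Num.sqrt (1 + c2 * gammap) * alphap) (pik alphap)).

Record adolf_run (R : realType) (m d : nat) (f : 'I_m -> 'rV[R]_d -> R)
    (W : 'M[R]_m) (c1 c2 : R) (sigma : nat -> R) (pi : nat -> R -> R)
    (Xm1 : 'M[R]_(m, d)) (X D : nat -> 'M[R]_(m, d))
    (alpha gamma : nat -> R) : Prop := AdolfRun {
  adolf_alpha0 : 0 < alpha 0%N;
  adolf_gamma0 : gamma 0%N = 1;
  adolf_D0 : D 0%N = 0;
  adolf_alpha : forall k, alpha k.+1 =
    stepsize c1 c2 (local_lip f (X k.+1) (X k)) (sigma k.+1)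
      (gamma k) (alpha k) (pi k.+1);
  adolf_gamma : forall k, gamma k.+1 = alpha k.+1 / alpha k;
  adolf_D : forall k, D k.+1 = D k + (sigma k * alpha k) *:
    ((1%:M - W) *m ((1 + gamma k) *: X k - gamma k *: prev Xm1 X k));
  adolf_X : forall k, X k.+1 = X k - alpha k *: (gradF f (X k) + D k.+1)
}.

Definition auxiliary_dual (R : realType) (m d : nat) (L : 'M[R]_m)
    (sigma alpha gamma : nat -> R) (Xm1 : 'M[R]_(m, d))
    (X Y : nat -> 'M[R]_(m, d)) : Prop :=
  Y 0%N = 0 /\
  forall k, Y k.+1 = Y k + (sigma k * alpha k) *:
    ((1 + gamma k) *: (L *m X k) - gamma k *: (L *m prev Xm1 X k)).

Definition theta (R : realType) (gamma : nat -> R) (k : nat) : R :=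
  \sum_(0 <= t < k) gamma t.

Definition ergodic_avg (R : realType) (m d : nat) (gamma : nat -> R)
    (X : nat -> 'M[R]_(m, d)) (k : nat) : 'M[R]_(m, d) :=
  (theta gamma k)^-1 *: \sum_(0 <= t < k) gamma t *: X t.

Definition merit (R : realType) (m d : nat) (f : 'I_m -> 'rV[R]_d -> R)
    (L : 'M[R]_m) (Xs Ys X : 'M[R]_(m, d)) : R :=
  sumF f X - sumF f Xs + frob_dot (L *m Ys) (X - Xs)
  + frob_norm (L *m X) ^+ 2.

Definition segment (R : realType) (p q : nat) (A B : 'M[R]_(p, q)) :
    set 'M[R]_(p, q) :=
  range (fun t : {i01 R} =>
    (A : convex_lmodType 'M[R]_(p, q)) <| t |> (B : convex_lmodType _)).

Definition convex_hull (R : realType) (p q : nat) (S : set 'M[R]_(p, q)) :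
    set 'M[R]_(p, q) :=
  \bigcap_(C in [set C : set 'M[R]_(p, q) |
      @convex_set R 'M[R]_(p, q) C /\ S `<=` C]) C.

Definition trajectory_hull (R : realType) (m d : nat) (Xm1 : 'M[R]_(m, d))
    (X : nat -> 'M[R]_(m, d)) : set 'M[R]_(m, d) :=
  convex_hull (\bigcup_t segment (prev Xm1 X t) (X t)).

(* Main.v *)
Require Import Defs.
From HB Require Import structures.
From mathcomp Require Import all_boot all_order all_algebra.
From mathcomp Require Import all_classical all_reals all_analysis.
From mathcomp Require Import ring lra.
Import Order.TTheory GRing.Theory Num.Theory.
Import numFieldNormedType.Exports.
Local Open Scope classical_set_scope.
Local Open Scope ring_scope.

Set Implicit Arguments.
Unset Strict Implicit.
Unset Printing Implicit Defensive.

(* For a pair (Xs, Ys) with L Xs = 0 and grad F(Xs) + L Ys = 0, set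
     P(X) = F(X) - F(Xs) + <L Ys, X - Xs>,
   which is nonnegative by convexity.  The energy
     |X^{k+1} - Xs|^2 + |Y^{k+1} - Ys|^2 / sigma^k + |X^{k+1} - X^k|^2 / 2
       + 2 alpha^k (1 + gamma^k) P(X^k)
   decreases along the iterations: the first argument of the minimum defining
   alpha^{k+1} ensures 2 alpha L + 2 sigma alpha^2 / c1 <= 1, which absorbs
   the cross terms, and the second one ensures
   alpha^{k+1} gamma^{k+1} <= (1 + c2 gamma^k) alpha^k, which makes the P-terms
   telescope.  Hence the
   iterates are bounded, grad F is Lipschitz along them, the stepsizes stay
   between two positive constants, and |X^{k+1} - X^k|^2, |Y^{k+1} - Y^k|^2 are
   summable.  Any cluster point is again such a pair, and the energy relative
   to it tends to 0 along a subsequence, hence along the whole sequence.  When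
   c2 < 1 the energy also loses a multiple of gamma^k P(X^k), so that
   sum_t gamma^t (P(X^t) + |L X^t|^2) is bounded, and the rate follows by
   convexity. *)

(** * Frobenius inner product and one step of the energy *)

Definition frob_sq (R : realType) (p q : nat) (A : 'M[R]_(p, q)) : R :=
  frob_dot A A.

Section FrobeniusAlgebra.
Context {R : realType} {p q : nat}.
Implicit Types (A B C : 'M[R]_(p, q)) (t : R).

Lemma frob_dotC A B : frob_dot A B = frob_dot B A.
Proof. by apply: eq_bigr => i _; apply: eq_bigr => j _; rewrite mulrC. Qed.

Lemma frob_dotDl A B C : frob_dot (A + B) C = frob_dot A C + frob_dot B C.
Proof.
rewrite -big_split; apply: eq_bigr => i _; rewrite -big_split.
by apply: eq_bigr => j _; rewrite mxE mulrDl.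
Qed.

Lemma frob_dotZl t A B : frob_dot (t *: A) B = t * frob_dot A B.
Proof.
rewrite mulr_sumr; apply: eq_bigr => i _; rewrite mulr_sumr.
by apply: eq_bigr => j _; rewrite mxE mulrA.
Qed.

Lemma frob_dotNl A B : frob_dot (- A) B = - frob_dot A B.
Proof. by rewrite -scaleN1r frob_dotZl mulN1r. Qed.

Lemma frob_dotBl A B C : frob_dot (A - B) C = frob_dot A C - frob_dot B C.
Proof. by rewrite frob_dotDl frob_dotNl. Qed.

Lemma frob_dotDr A B C : frob_dot A (B + C) = frob_dot A B + frob_dot A C.
Proof. by rewrite !(frob_dotC A) frob_dotDl. Qed.

Lemma frob_dotZr t A B : frob_dot A (t *: B) = t * frob_dot A B.
Proof. by rewrite !(frob_dotC A) frob_dotZl. Qed.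

Lemma frob_dotNr A B : frob_dot A (- B) = - frob_dot A B.
Proof. by rewrite !(frob_dotC A) frob_dotNl. Qed.

Lemma frob_dotBr A B C : frob_dot A (B - C) = frob_dot A B - frob_dot A C.
Proof. by rewrite !(frob_dotC A) frob_dotBl. Qed.

Lemma frob_dot0l A : frob_dot 0 A = 0.
Proof. by rewrite -(scale0r A) frob_dotZl mul0r. Qed.

Lemma frob_dot_suml (I : Type) (r : seq I) (P : pred I) (u : I -> 'M[R]_(p, q)) A :
  frob_dot (\sum_(i <- r | P i) u i) A = \sum_(i <- r | P i) frob_dot (u i) A.
Proof.
by apply: (@big_morph _ _ (fun B => frob_dot B A) 0 +%R 0 +%R) => [B C|];
  rewrite ?frob_dotDl ?frob_dot0l.
Qed.

Lemma frob_sq_ge0 A : 0 <= frob_sq A.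
Proof. by apply: sumr_ge0 => i _; apply: sumr_ge0 => j _; exact: sqr_ge0. Qed.

Lemma frob_sq_entry A i j : A i j ^+ 2 <= frob_sq A.
Proof.
rewrite /frob_sq /frob_dot (bigD1 i)//= (bigD1 j)//= -addrA lerDl addr_ge0//.
  by apply: sumr_ge0 => *; exact: sqr_ge0.
by apply: sumr_ge0 => *; apply: sumr_ge0 => *; exact: sqr_ge0.
Qed.

Lemma frob_sq_le0 A : frob_sq A <= 0 -> A = 0.
Proof.
move=> A0; apply/matrixP => i j; rewrite mxE; apply/eqP.
by rewrite -sqrf_eq0 eq_le sqr_ge0 (le_trans (frob_sq_entry A i j)).
Qed.

Lemma frob_sqN A : frob_sq (- A) = frob_sq A.
Proof. by rewrite /frob_sq frob_dotNl frob_dotNr opprK. Qed.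

Lemma frob_sqBC A B : frob_sq (A - B) = frob_sq (B - A).
Proof. by rewrite -opprB frob_sqN. Qed.

Lemma frob_sqZ t A : frob_sq (t *: A) = t ^+ 2 * frob_sq A.
Proof. by rewrite /frob_sq frob_dotZl frob_dotZr mulrA. Qed.

Lemma frob_sqD A B :
  frob_sq (A + B) = frob_sq A + 2 * frob_dot A B + frob_sq B.
Proof. by rewrite /frob_sq frob_dotDl !frob_dotDr (frob_dotC B A); ring. Qed.

Lemma frob_normE A : frob_norm A ^+ 2 = frob_sq A.
Proof. by rewrite sqr_sqrtr// frob_sq_ge0. Qed.

Lemma frob_norm_ge0 A : 0 <= frob_norm A.
Proof. exact: sqrtr_ge0. Qed.

Lemma frob_young t A B : 0 < t ->
  2 * frob_dot A B <= t * frob_sq A + t^-1 * frob_sq B.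
Proof.
move=> t0; have := frob_sq_ge0 (t *: A - B); rewrite frob_sqD frob_sqZ.
rewrite frob_sqN frob_dotNr frob_dotZl => /(ler_wpM2l (ltW (_ : 0 < t^-1))).
rewrite invr_gt0 mulr0 => /(_ t0).
have -> : t^-1 * (t ^+ 2 * frob_sq A + 2 * - (t * frob_dot A B) + frob_sq B) =
  t * frob_sq A - 2 * frob_dot A B + t^-1 * frob_sq B by field; rewrite gt_eqF.
by move=> ?; lra.
Qed.

Lemma frob_sqD_le A B : frob_sq (A + B) <= 2 * (frob_sq A + frob_sq B).
Proof.
have := @frob_young 1 A B ltr01; rewrite frob_sqD invr1 !mul1r => ?; lra.
Qed.

(* Young's inequality with the weight chosen so that no quotient by the
   possibly vanishing factor l appears. *)
Lemma frob_dot_lip l A B C : 0 <= l -> frob_sq A <= l ^+ 2 * frob_sq B ->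
  2 * frob_dot A C <= l * (frob_sq B + frob_sq C).
Proof.
rewrite le_eqVlt => /predU1P[<-|l0 AB].
  by rewrite expr0n mul0r => /frob_sq_le0 ->; rewrite frob_dot0l mulr0 mul0r.
rewrite (le_trans (@frob_young l^-1 A C _)) ?invr_gt0// invrK mulrDr lerD2r.
rewrite (le_trans (ler_wpM2l _ AB)) ?invr_ge0 ?(ltW l0)//.
by rewrite expr2 -mulrA mulKf// gt_eqF.
Qed.

End FrobeniusAlgebra.

Lemma frob_dot_adjoint {R : realType} (p q : nat) (L : 'M[R]_p)
    (A B : 'M[R]_(p, q)) :
  L^T = L -> frob_dot (L *m A) B = frob_dot A (L *m B).
Proof.
move=> LT; have tr (C D : 'M[R]_(p, q)) : frob_dot C D = \tr (C^T *m D).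
  rewrite /frob_dot exchange_big; apply: eq_bigr => j _; rewrite mxE.
  by apply: eq_bigr => i _; rewrite mxE.
by rewrite !tr trmx_mul LT mulmxA.
Qed.

(* The squared norm N of the new increment [xn - x] is written 2 N - N and one
   copy is expanded through the previous increment, following Malitsky and
   Mishchenko; the cross terms carrying [L *m yn] then cancel against the dual
   update because of the extrapolation. *)
Lemma energy_step {R : realType} (p q : nat) (L : 'M[R]_p)
    (xp x xn y yn g gp Xs Ys : 'M[R]_(p, q)) (ap a gam s l c1 Fp Fx Fs : R) :
  L^T = L -> (forall A : 'M[R]_(p, q), frob_sq (L *m A) <= frob_sq A) ->
  0 < ap -> 0 < s -> 0 < c1 -> 0 <= l -> 0 < a -> gam = a / ap ->
  2 * a * l + 2 * s * a ^+ 2 / c1 <= 1 ->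
  xn = x - a *: (g + L *m yn) -> x = xp - ap *: (gp + L *m y) ->
  yn = y + (s * a) *: ((1 + gam) *: (L *m x) - gam *: (L *m xp)) ->
  frob_sq (g - gp) <= l ^+ 2 * frob_sq (x - xp) ->
  Fx + frob_dot g (Xs - x) <= Fs -> Fx + frob_dot g (xp - x) <= Fp ->
  L *m Xs = 0 ->
  frob_sq (xn - Xs) + frob_sq (yn - Ys) / s + frob_sq (xn - x) / 2 +
    2 * a * (1 + gam) * (Fx - Fs + frob_dot (L *m Ys) (x - Xs)) <=
  frob_sq (x - Xs) + frob_sq (y - Ys) / s + frob_sq (x - xp) / 2 +
    2 * a * gam * (Fp - Fs + frob_dot (L *m Ys) (xp - Xs))
  - (1 - c1) / s * frob_sq (yn - y) - s * a ^+ 2 / c1 * frob_sq (x - xp).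
Proof.
move=> LT Lle ap0 s0 c10 l0 a0 gamE step xnE xE ynE glip convs convp LXs.
(* Here [dp] and [dn] are the previous and the new primal increment, [e] is the dual increment, and
   [w], [h] are the errors relative to [Xs], [Ys]. *)
have gamap : gam * ap = a by rewrite gamE divfK// gt_eqF.
pose w := x - Xs; pose dp := x - xp; pose dn := xn - x; pose h := yn - Ys.
pose e := yn - y.
have dnE : dn = - (a *: (g + L *m yn)) by rewrite /dn xnE addrC addKr.
(* Writing [L y] as [L yn - L e] makes both primal increments carry the same dual term [L yn], which
   can then cancel. *)
have dpE : dp = - (ap *: (gp + (L *m yn - L *m e))).
  by rewrite /dp {1}xE addrC addKr /e mulmxBr subKr.
have eE : e = (s * a) *: (L *m (w + gam *: dp)).
  rewrite /e ynE addrC addKr; congr (_ *: _).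
  rewrite /w /dp mulmxDr mulmxBr LXs subr0 -scalemxAr mulmxBr scalerBr.
  by rewrite scalerDl scale1r addrA.
have E1 : frob_sq (xn - Xs) = frob_sq w + 2 * frob_dot dn w + frob_sq dn.
  have -> : xn - Xs = w + dn by rewrite [RHS]addrC subrKA.
  by rewrite frob_sqD (frob_dotC w).
have E2 : frob_sq (y - Ys) = frob_sq h - 2 * frob_dot e h + frob_sq e.
  have -> : y - Ys = h - e by rewrite /h /e opprB [RHS]addrC subrKA.
  by rewrite frob_sqD frob_dotNr frob_sqN (frob_dotC h); ring.
have E3 : frob_dot e h = s * a * (frob_dot (L *m yn) w +
    gam * frob_dot (L *m yn) dp - frob_dot (L *m Ys) w
    - gam * frob_dot (L *m Ys) dp).
  rewrite eE frob_dotZl (frob_dot_adjoint _ _ LT) mulmxBr frob_dotBr.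
  rewrite !(frob_dotDl w) !frob_dotZl !(frob_dotC w) !(frob_dotC dp); ring.
have E4 : frob_dot dn w = - a * (frob_dot g w + frob_dot (L *m yn) w).
  by rewrite dnE frob_dotNl frob_dotZl frob_dotDl mulNr.
(* The product of the two increments is computed twice: here by expanding [dn], in [E7] by expanding
   [dp]. Comparing [E7] with [E6] leaves only the differences [g - gp] and [L e] paired with
   [dn]. *)
have E5 : frob_dot dn dp = - a * (frob_dot g dp + frob_dot (L *m yn) dp).
  by rewrite dnE frob_dotNl frob_dotZl frob_dotDl mulNr.
have E6 : frob_sq dn = - a * (frob_dot g dn + frob_dot (L *m yn) dn).
  by rewrite /frob_sq {1}dnE frob_dotNl frob_dotZl frob_dotDl mulNr.
have E7 : frob_dot dn dp = - ap * (frob_dot gp dn +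
    (frob_dot (L *m yn) dn - frob_dot (L *m e) dn)).
  by rewrite frob_dotC {1}dpE frob_dotNl frob_dotZl frob_dotDl frob_dotBl mulNr.
have E8 : frob_dot g (Xs - x) = - frob_dot g w by rewrite -opprB frob_dotNr.
have E9 : frob_dot g (xp - x) = - frob_dot g dp by rewrite -opprB frob_dotNr.
have E10 : frob_dot (L *m Ys) (xp - Xs) =
    frob_dot (L *m Ys) w - frob_dot (L *m Ys) dp.
  by rewrite -frob_dotBr /w /dp opprB [in RHS]addrC subrKA.
have Y1 : - (2 * frob_dot (g - gp) dn) <= l * (frob_sq dp + frob_sq dn).
  by rewrite -(frob_sqN dn) -mulrN -frob_dotNr; exact: frob_dot_lip.
(* With the weight [c1 / s], Young's inequality consumes only the fraction [c1] of the available
   [frob_sq e / s]; the rest is the dual decrease. *)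
have Y2 : - (2 * a * frob_dot (L *m e) dn) <=
    c1 / s * frob_sq e + s * a ^+ 2 / c1 * frob_sq dn.
  have c1s : 0 < c1 / s by rewrite divr_gt0.
  have := frob_young (L *m e) (- (a *: dn)) c1s.
  rewrite frob_dotNr frob_sqN frob_dotZr frob_sqZ invf_div.
  have : c1 / s * frob_sq (L *m e) <= c1 / s * frob_sq e.
    by rewrite ler_wpM2l ?(ltW c1s).
  have -> : s * a ^+ 2 / c1 = s / c1 * a ^+ 2 by ring.
  by rewrite -mulrA => ? ?; lra.
rewrite frob_dotBl in Y1.
rewrite E1 E2 E10 -/w -/dp -/dn -/h -/e.
rewrite -(ler_pM2l a0) in Y1.
rewrite E8 -subr_ge0 -(pmulr_rge0 _ a0) in convs.
rewrite E9 -subr_ge0 -(pmulr_rge0 _ a0) in convp.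
have gam0 : 0 < gam by rewrite gamE divr_gt0.
rewrite -(pmulr_rge0 _ gam0) in convp.
(* On [dn] the stepsize condition absorbs both Young terms into half of [frob_sq dn]; on [dp] it
   absorbs the [l] term and leaves the primal decrease. *)
have step' : (2 * a * l + 2 * s * a ^+ 2 / c1) * frob_sq dn <= frob_sq dn.
  by rewrite ler_piMl// frob_sq_ge0.
have step'' : (2 * a * l + 2 * s * a ^+ 2 / c1) * frob_sq dp <= frob_sq dp.
  by rewrite ler_piMl// frob_sq_ge0.
have E7' : gam * frob_dot dn dp = - a * (frob_dot gp dn +
    (frob_dot (L *m yn) dn - frob_dot (L *m e) dn)).
  by rewrite E7 -gamap; ring.
have E3' : frob_dot e h / s = a * (frob_dot (L *m yn) w +
    gam * frob_dot (L *m yn) dp - frob_dot (L *m Ys) w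
    - gam * frob_dot (L *m Ys) dp).
  by rewrite E3; field; rewrite gt_eqF.
rewrite E5 in E7'.
clear E1 E2 E3 E5 E7 E8 E9 E10 glip Lle gamE gamap step.
have -> : (frob_sq h - 2 * frob_dot e h + frob_sq e) / s =
  frob_sq h / s - 2 * (frob_dot e h / s) + frob_sq e / s by ring.
rewrite E3' E4.
move: E6 E7' Y1 Y2 convs convp step' step'' => {dnE dpE eE E3' E4 xnE xE ynE}.
rewrite -(mulrA (2 * s)) -(mulrA s) -(mulrA 2 s).
rewrite !(mulrBl (s^-1)) !mul1r.
set T := s * _; set v := c1 / s.
lra.
Qed.

(** * Gradients on bounded sets, compactness *)

Section NormComparison.
Context {R : realType} {p q : nat}.
Implicit Types A : 'M[R]_(p, q).

Lemma mx_entry_le_norm A i j : `|A i j| <= `|A|.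
Proof.
rewrite [leRHS]/Num.norm /= mx_normrE.
by apply: (le_trans _ (le_bigmax _ (fun ij => `|A ij.1 ij.2|) (i, j))).
Qed.

Lemma mx_norm_le_frob A : `|A| <= frob_norm A.
Proof.
rewrite [leLHS]/Num.norm /= mx_normrE; apply/bigmax_leP; split => [|ij _].
  exact: frob_norm_ge0.
rewrite -(ler_pXn2r (ltn0Sn 1)) ?nnegrE ?frob_norm_ge0//.
by rewrite frob_normE real_normK ?num_real// frob_sq_entry.
Qed.

Lemma frob_sq_le_mx_norm A : frob_sq A <= (p * q)%:R * `|A| ^+ 2.
Proof.
apply: (le_trans (y := \sum_(i < p) \sum_(j < q) `|A| ^+ 2)).
  apply: ler_sum => i _; apply: ler_sum => j _.
  by rewrite -expr2 -real_normK ?num_real// lerXn2r ?nnegrE// mx_entry_le_norm.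
by rewrite !sumr_const !card_ord -mulrnA mulnC mulr_natl.
Qed.

Lemma frob_norm_le_mx_norm A : frob_norm A <= (p * q)%:R * `|A|.
Proof.
rewrite -(ler_pXn2r (ltn0Sn 1)) ?nnegrE ?frob_norm_ge0 ?mulr_ge0//.
rewrite frob_normE (le_trans (frob_sq_le_mx_norm A))// exprMn ler_wpM2r//.
by rewrite -natrX ler_nat -mulnn; case: (p * q)%N => // n; rewrite leq_pmulr.
Qed.

End NormComparison.

Lemma grad_dotE {R : realType} (d : nat) (g : 'rV[R]_d -> R) x v :
  differentiable g x -> 'D_v g x = frob_dot (grad g x) v.
Proof.
move=> dg; rewrite deriveE// {1}(row_sum_delta v) linear_sum.
rewrite /frob_dot big_ord1; apply: eq_bigr => j _.
by rewrite linearZ /= -deriveE// mxE mulrC.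
Qed.

(** By convexity the difference quotients at [x] in the direction [y - x] with step in (0, 1] are at
    most [g y - g x]; their limit from the right is the directional derivative. *)
Lemma convex_grad_ineq {R : realType} (d : nat) (g : 'rV[R]_d -> R) x y :
  differentiable g x -> convex_on_space g ->
  g x + frob_dot (grad g x) (y - x) <= g y.
Proof.
move=> dg cg; rewrite -grad_dotE// addrC -lerBrDr.
have dv : derivable g x (y - x) by exact: diff_derivable.
have /cvg_dnbhs_at_right/cvgr_to_le := dv; apply.
near=> h.
have h0 : 0 < h by near: h; exact: nbhs_right_gt.
have h1 : h <= 1 by near: h; exact: nbhs_right_le.
rewrite -[_ *: _]/(_ * _) ler_pdivrMl//= addrC.
have := cg (Itv01 (ltW h0) h1) y x; rewrite !inE => /(_ Logic.I Logic.I).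
rewrite convRE /= => convg.
have {}convg : g (h *: y + (1 - h) *: x) <= h * g y + (1 - h) * g x := convg.
have -> : h *: (y - x) + x = h *: y + (1 - h) *: x.
  by rewrite scalerBr scalerBl scale1r -addrA (addrC _ x).
lra.
Unshelve. all: by end_near. Qed.

(** A covering argument on pairs of points of [A]. Near the diagonal a local Lipschitz constant
    serves; away from it the distance of the points is bounded below and the difference of the
    values is bounded above. *)
Lemma locally_lipschitz_compact {R : realType} (p q r s : nat)
    (g : 'M[R]_(p, q) -> 'M[R]_(r, s)) (A : set 'M[R]_(p, q)) :
  continuous g ->
  (forall x : 'M[R]_(p, q), exists (U : set 'M[R]_(p, q)) (K : R),
    nbhs x U /\ frob_lipschitz K U g) ->
  compact A -> exists2 K, 0 < K & frob_lipschitz K A g.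
Proof.
move=> cg lg cA.
have : \forall K \near +oo, forall z, (A `*` A) z ->
    frob_norm (g z.1 - g z.2) <= K * frob_norm (z.1 - z.2).
  have /compact_near_coveringP := compact_setX cA cA; apply => -[x y] /= [Ax Ay].
  have [<-|xy] := eqVneq x y.
    have [U [K [xU KU]]] := lg x.
    exists (U `*` U, [set M | K <= M]) => /=.
      split; first by exists (U, U).
      exact: (@nbhs_pinfty_ge _ K (num_real K)).
    move=> [[u v] M] /= [[Uu Uv] KM].
    by rewrite (le_trans (KU _ _ Uu Uv))// ler_wpM2r// frob_norm_ge0.
  (* Moving [x] and [y] by at most a quarter of their distance keeps them [2 * eps] apart, while [c]
     bounds the difference of the values of [g]. *)
  pose eps := `|x - y| / 4.
  have eps0 : 0 < eps by rewrite divr_gt0// normr_gt0 subr_eq0.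
  pose c := (r * s)%:R * (`|g x| + `|g y| + 2).
  exists ([set u | `|x - u| <= eps /\ `|g x - g u| <= 1] `*`
     [set v | `|y - v| <= eps /\ `|g y - g v| <= 1],
     [set M | c / (2 * eps) <= M]) => /=.
    split; last exact: (nbhs_pinfty_ge (num_real _)).
    exists ([set u | `|x - u| <= eps /\ `|g x - g u| <= 1],
     [set v | `|y - v| <= eps /\ `|g y - g v| <= 1]) => //=.
    split; near=> u; split.
    - by near: u; apply: (cvgr_dist_le id) => //; exact: cvg_id.
    - by near: u; apply: (cvgr_dist_le g) => //; exact: cg.
    - by near: u; apply: (cvgr_dist_le id) => //; exact: cvg_id.
    - by near: u; apply: (cvgr_dist_le g) => //; exact: cg.
  move=> [[u v] M] /= [[[xu gxu] [yv gyv]] cM].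
  have uv : 2 * eps <= frob_norm (u - v).
    apply: le_trans (mx_norm_le_frob _).
    have : `|x - y| <= `|x - u| + `|u - v| + `|y - v|.
      have -> : x - y = (x - u) + (u - v) + (v - y) by rewrite subrKA subrKA.
      by rewrite (distrC y v) (le_trans (ler_normD _ _))// lerD2r ler_normD.
    by rewrite /eps in xu yv *; lra.
  have M0 : 0 <= M.
    by apply: le_trans cM; rewrite divr_ge0 ?mulr_ge0 ?addr_ge0// ltW.
  have eps20 : 0 < 2 * eps by rewrite pmulr_rgt0.
  apply: (@le_trans _ _ (M * (2 * eps))); last by rewrite ler_wpM2l.
  rewrite -ler_pdivrMr//; apply: le_trans cM.
  rewrite ler_pM2r ?invr_gt0//.
  rewrite (le_trans (frob_norm_le_mx_norm _))// ler_wpM2l//.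
  have -> : g u - g v = (g x - g v) - (g x - g u).
    by rewrite opprB [RHS]addrC subrKA.
  have := ler_normB (g x - g v) (g x - g u).
  have := ler_normB (g y - g v) (g y - g x).
  have -> : g y - g v - (g y - g x) = g x - g v.
    by rewrite opprB [LHS]addrC subrKA.
  have := ler_normB (g y) (g x).
  by move: gxu gyv => ? ? ? ? ?; lra.
move=> nearK.
have [K [K0 HK]] : exists K, 0 < K /\ forall z, (A `*` A) z ->
    frob_norm (g z.1 - g z.2) <= K * frob_norm (z.1 - z.2).
  near (pinfty_nbhs R) => K; exists K; split; near: K => //.
  exact: nbhs_pinfty_gt.
by exists K => // x y Ax Ay; exact: (HK (x, y)).
Unshelve. all: by end_near. Qed.

Lemma frob_sq_rows {R : realType} (p q : nat) (A : 'M[R]_(p, q)) :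
  frob_sq A = \sum_(i < p) frob_sq (row i A).
Proof.
apply: eq_bigr => i _; rewrite /frob_sq /frob_dot big_ord1.
by apply: eq_bigr => j _; rewrite !mxE.
Qed.

Lemma frob_sq_lipschitz {R : realType} (p q r s : nat) (K : R)
    (S : set 'M[R]_(p, q)) (g : 'M[R]_(p, q) -> 'M[R]_(r, s)) x y :
  frob_lipschitz K S g -> S x -> S y ->
  frob_sq (g x - g y) <= K ^+ 2 * frob_sq (x - y).
Proof.
move=> lg Sx Sy; rewrite -!frob_normE -exprMn.
have gxy := lg _ _ Sx Sy.
by rewrite lerXn2r// nnegrE ?(le_trans _ gxy)// frob_norm_ge0.
Qed.

(** The bound [B + 1] dominates the square root of [B] and keeps radicals out of later radii. *)
Lemma mx_norm_le_frob_sq {R : realType} (p q : nat) (A : 'M[R]_(p, q)) (B : R) :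
  frob_sq A <= B -> `|A| <= B + 1.
Proof.
move=> AB; have B0 := le_trans (frob_sq_ge0 A) AB.
rewrite (le_trans (mx_norm_le_frob A))//.
rewrite -(ler_pXn2r (ltn0Sn 1)) ?nnegrE ?frob_norm_ge0 ?addr_ge0//.
by rewrite frob_normE; nra.
Qed.

Lemma rV_ball_compact {R : realType} (q : nat) (B : R) :
  compact [set x : 'rV[R]_q | `|x| <= B].
Proof.
apply: bounded_closed_compact.
  by exists B; split=> [|M BM x /= xB]; [exact: num_real|exact: le_trans (ltW BM)].
apply: (@closed_comp _ _ (@Num.norm R 'rV[R]_q) [set y | y <= B]).
  by move=> x _; exact: norm_continuous.
exact: closed_le.
Qed.

Lemma gradF_lipschitz_ball {R : realType} (m d : nat)
    (f : 'I_m -> 'rV[R]_d -> R) (B : R) :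
  (forall i, continuously_differentiable (f i)) ->
  (forall i, locally_smooth (f i)) ->
  exists2 K, 0 < K & frob_lipschitz K [set X | frob_sq X <= B] (gradF f).
Proof.
move=> fC1 fS.
have /choice[K KP] : forall i, exists K, 0 < K /\
    frob_lipschitz K [set x : 'rV_d | `|x| <= B + 1] (grad (f i)).
  move=> i; have [_ cg] := fC1 i.
  have [K K0 KP] := locally_lipschitz_compact cg (fS i) (@rV_ball_compact R d (B + 1)).
  by exists K.
(* The gradient acts row by row, so any number above every [K i] works; the summand 1 makes it
   positive. *)
exists (1 + \sum_i K i).
  by rewrite ltr_wpDr// sumr_ge0// => i _; rewrite ltW//; case: (KP i).
move=> X Z /= XB ZB.
have K0 : 0 <= 1 + \sum_i K i.
  by rewrite addr_ge0// sumr_ge0// => i _; rewrite ltW//; case: (KP i).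
rewrite -(ler_pXn2r (ltn0Sn 1)) ?nnegrE ?mulr_ge0 ?frob_norm_ge0//.
rewrite exprMn !frob_normE !frob_sq_rows mulr_sumr; apply: ler_sum => i _.
have rowB (A : 'M[R]_(m, d)) : frob_sq A <= B -> `|row i A| <= B + 1.
  move=> AB; apply: mx_norm_le_frob_sq; apply: le_trans AB.
  rewrite (frob_sq_rows A) (bigD1 i)//= lerDl sumr_ge0//.
  by move=> *; exact: frob_sq_ge0.
have rowg A : row i (gradF f A) = grad (f i) (row i A).
  by apply/rowP => j; rewrite !mxE.
have [Ki0 KiP] := KP i.
rewrite !linearB /= !rowg (le_trans (frob_sq_lipschitz KiP _ _))//; try exact: rowB.
rewrite ler_wpM2r ?frob_sq_ge0// lerXn2r ?nnegrE// ?ltW//.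
rewrite (bigD1 i)//= addrCA ltrDl ltr_wpDr//.
by rewrite sumr_ge0// => j _; rewrite ltW//; case: (KP j).
Qed.

Lemma frob_ball_convex {R : realType} (p q : nat) (B : R) :
  @convex_set R 'M[R]_(p, q) [set X | frob_sq X <= B].
Proof.
move=> X Z t; rewrite !inE /= => XB ZB.
have [t0 t1] : 0 <= t%:num /\ t%:num <= 1 by split.
have -> : conv t X Z = t%:num *: (X : 'M[R]_(p, q)) + (1 - t%:num) *: (Z : 'M[R]_(p, q)).
  by [].
move: t%:num t0 t1 => u u0 u1.
have := @frob_young R p q 1 X Z ltr01.
rewrite frob_sqD !frob_sqZ frob_dotZl frob_dotZr invr1 !mul1r => XZ.
have : u * (1 - u) * (2 * frob_dot X Z) <= u * (1 - u) * (frob_sq X + frob_sq Z).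
  by rewrite ler_wpM2l// mulr_ge0// subr_ge0.
have : u * frob_sq X <= u * B by rewrite ler_wpM2l.
have : (1 - u) * frob_sq Z <= (1 - u) * B by rewrite ler_wpM2l// subr_ge0.
nra.
Qed.

(** Confines the hull to a ball, on which [gradF] is Lipschitz; a Lipschitz constant on the hull
    therefore exists. *)
Lemma trajectory_hull_sub {R : realType} (m d : nat) (Xm1 : 'M[R]_(m, d))
    (X : nat -> 'M[R]_(m, d)) (B : R) :
  frob_sq Xm1 <= B -> (forall k, frob_sq (X k) <= B) ->
  trajectory_hull Xm1 X `<=` [set Z | frob_sq Z <= B].
Proof.
move=> Xm1B XB Z; apply; split; first exact: frob_ball_convex.
move=> V [k _ [t _ <-]].
have prevB : frob_sq (Defs.prev Xm1 X k) <= B by case: k.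
have := @frob_ball_convex R m d B (Defs.prev Xm1 X k) (X k) t.
by rewrite !inE => convB; apply: convB => /=.
Qed.

(** * Cluster points of bounded sequences *)

Lemma bounded_seq_cluster {R : realType} (q : nat) (z : nat -> 'rV[R]_q) (B : R) :
  (forall n, frob_sq (z n) <= B) ->
  exists zs, forall eps N, 0 < eps ->
    exists2 n, (N <= n)%N & frob_sq (z n - zs) < eps.
Proof.
move=> zB; have := @rV_ball_compact R q (B + 1).
move=> /(_ (z @ \oo) _); case.
  by exists 0%N => // n _; exact: mx_norm_le_frob_sq.
move=> zs [_ zsP]; exists zs => eps N eps0.
(* Below 1 a square is at most its base, so a linear bound on the distance suffices; [q.+1] stays
   nonzero when [q] is 0. *)
pose e := Num.min 1 (eps / (q.+1)%:R).
have e0 : 0 < e by rewrite lt_min ltr01 divr_gt0.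
have tail : (z @ \oo) (z @` [set n | (N <= n)%N]).
  by exists N => // n Nn; exists n.
have [_ [[n Nn <-] zsn]] := zsP _ _ tail (nbhsx_ballx zs e e0).
exists n => //; move: zsn; rewrite -ball_normE /= distrC => zsn.
rewrite (le_lt_trans (frob_sq_le_mx_norm _))// mul1n.
have q0 : 0 < q.+1%:R :> R by [].
have z1 : `|z n - zs| <= 1 by rewrite ltW// (lt_le_trans zsn)// ge_min lexx.
have : `|z n - zs| < eps / q.+1%:R.
  by rewrite (lt_le_trans zsn)// ge_min lexx orbT.
rewrite ltr_pdivlMr// mulrC => /(le_lt_trans _); apply.
rewrite ler_pM ?exprn_ge0// ?ler_nat// expr2 ler_piMl//.
Qed.

(** Both matrices are flattened into a single row vector, so that one compactness argument
    approximates the two limits at common indices. *)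
Lemma bounded_pair_cluster {R : realType} (p q : nat)
    (X Y : nat -> 'M[R]_(p, q)) (B : R) :
  (forall n, frob_sq (X n) <= B) -> (forall n, frob_sq (Y n) <= B) ->
  exists Xs Ys, forall eps N, 0 < eps ->
    exists2 n, (N <= n)%N & frob_sq (X n - Xs) + frob_sq (Y n - Ys) < eps.
Proof.
move=> XB YB.
have vecE (A : 'M[R]_(p, q)) : frob_sq (mxvec A) = frob_sq A.
  rewrite /frob_sq /frob_dot big_ord1 pair_bigA.
  rewrite (reindex _ (curry_mxvec_bij p q)) /=.
  by apply: eq_bigr => -[i j] _; rewrite /= mxvecE.
have rowE (A C : 'rV[R]_(p * q)) :
    frob_sq (row_mx A C) = frob_sq A + frob_sq C.
  rewrite /frob_sq /frob_dot !big_ord1 big_split_ord.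
  by congr (_ + _); apply: eq_bigr => j _; rewrite ?row_mxEl ?row_mxEr.
pose z n := row_mx (mxvec (X n)) (mxvec (Y n)).
have /bounded_seq_cluster[zs zsP] : forall n, frob_sq (z n) <= B + B.
  by move=> n; rewrite rowE !vecE lerD.
exists (vec_mx (lsubmx zs)), (vec_mx (rsubmx zs)) => eps N /(zsP _ N)[n Nn nP].
exists n => //; apply: le_lt_trans nP.
have -> : z n - zs = row_mx (mxvec (X n) - lsubmx zs) (mxvec (Y n) - rsubmx zs).
  by rewrite -{1}(hsubmxK zs) opp_row_mx add_row_mx.
by rewrite rowE -!vecE !linearB /= !vec_mxK.
Qed.

Lemma frob_sq_cvg {R : realType} (p q : nat) (z : nat -> 'M[R]_(p, q)) zs :
  (forall eps, 0 < eps -> exists N, forall n, (N <= n)%N ->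
    frob_sq (z n - zs) < eps) -> z @ \oo --> zs.
Proof.
move=> zP; apply/cvgrPdist_lt => eps eps0.
have [N NP] := zP (eps ^+ 2) (exprn_gt0 2 eps0).
exists N => // n /= Nn; rewrite distrC (le_lt_trans (mx_norm_le_frob _))//.
rewrite -(ltr_pXn2r (ltn0Sn 1)) ?nnegrE ?frob_norm_ge0 ?(ltW eps0)//.
by rewrite frob_normE NP.
Qed.

(** * Gossip matrices and their square roots *)

Lemma frob_dot_rows {R : realType} (p q : nat) (A B : 'M[R]_(p, q)) :
  frob_dot A B = \sum_(i < p) frob_dot (row i A) (row i B).
Proof.
apply: eq_bigr => i _; rewrite /frob_dot big_ord1.
by apply: eq_bigr => j _; rewrite !mxE.
Qed.

Lemma weighted_rows_sum {R : realType} (m d : nat) (w : 'I_m -> 'I_m -> R)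
    (A : 'M[R]_(m, d)) : (forall i, \sum_j w i j = 1) ->
  \sum_i \sum_j w i j * frob_sq (row i A) = frob_sq A.
Proof.
move=> w1; rewrite frob_sq_rows; apply: eq_bigr => i _.
by rewrite -mulr_suml w1 mul1r.
Qed.

Lemma weighted_cols_sum {R : realType} (m d : nat) (w : 'I_m -> 'I_m -> R)
    (A : 'M[R]_(m, d)) : (forall j, \sum_i w i j = 1) ->
  \sum_i \sum_j w i j * frob_sq (row j A) = frob_sq A.
Proof.
by move=> w1; rewrite exchange_big; exact: (@weighted_rows_sum _ _ _ (fun i j => w j i)).
Qed.

(** The Dirichlet form of a weighted graph Laplacian: when the squares are expanded, unit row and
    column sums turn each pure term into [frob_sq A]. *)
Lemma doubly_stochastic_quadratic {R : realType} (m d : nat) (Wt : 'M[R]_m)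
    (A : 'M[R]_(m, d)) : doubly_stochastic Wt ->
  2 * frob_dot ((1%:M - Wt) *m A) A =
  \sum_(i < m) \sum_(j < m) Wt i j * frob_sq (row i A - row j A).
Proof.
move=> [_ rowsum colsum].
have WA : frob_dot (Wt *m A) A =
    \sum_(i < m) \sum_(j < m) Wt i j * frob_dot (row i A) (row j A).
  rewrite frob_dot_rows; apply: eq_bigr => i _.
  have -> : row i (Wt *m A) = \sum_j Wt i j *: row j A.
    by apply/rowP => k; rewrite !mxE summxE; apply: eq_bigr => j _; rewrite !mxE.
  rewrite frob_dot_suml; apply: eq_bigr => j _.
  by rewrite frob_dotZl frob_dotC.
have := weighted_rows_sum A rowsum; have := weighted_cols_sum A colsum.
move=> colA rowA.
have sqE i j : Wt i j * frob_sq (row i A - row j A) =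
    Wt i j * frob_sq (row i A) + Wt i j * frob_sq (row j A) +
    -2 * (Wt i j * frob_dot (row i A) (row j A)).
  by rewrite frob_sqD frob_sqN frob_dotNr; ring.
under [RHS]eq_bigr do
  (under eq_bigr do rewrite sqE; rewrite !big_split /= -mulr_sumr).
rewrite !big_split /= -mulr_sumr rowA colA -WA mulmxBl mul1mx frob_dotBl.
by rewrite -/(frob_sq A); ring.
Qed.

Section GossipSquareRoot.
Context {R : realType} {m : nat} {e : rel 'I_m} {Wt : 'M[R]_m} {c : R}
  {L : 'M[R]_m}.
Hypothesis e_conn : undirected_connected e.
Hypothesis Wt_gossip : gossip_matrix e Wt.
Hypothesis c_bounds : 0 < c < 1 / 2.
Hypothesis LT : L^T = L.
Hypothesis LL : L *m L = c *: (1%:M - Wt).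

Lemma gossip_sqrt_sq (d : nat) (A : 'M[R]_(m, d)) : 2 * frob_sq (L *m A) =
  c * \sum_(i < m) \sum_(j < m) Wt i j * frob_sq (row i A - row j A).
Proof.
case: Wt_gossip => _ ds _ _ _.
rewrite -doubly_stochastic_quadratic// /frob_sq frob_dot_adjoint// mulmxA LL.
by rewrite -scalemxAl frob_dotZr frob_dotC; ring.
Qed.

(** Bounding the square of a difference by twice the sum of the squares gives a Dirichlet form of at
    most [4 * frob_sq A]; then [c < 1 / 2] suffices. *)
Lemma gossip_sqrt_contract (d : nat) (A : 'M[R]_(m, d)) :
  frob_sq (L *m A) <= frob_sq A.
Proof.
have [c0 c12] := andP c_bounds.
have [_ [W0 rowsum colsum] _ _ _] := Wt_gossip.
have : \sum_(i < m) \sum_(j < m) Wt i j * frob_sq (row i A - row j A) <=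
    \sum_(i < m) \sum_(j < m)
      (2 * (Wt i j * frob_sq (row i A)) + 2 * (Wt i j * frob_sq (row j A))).
  apply: ler_sum => i _; apply: ler_sum => j _.
  have := frob_sqD_le (row i A) (- row j A).
  rewrite frob_sqN => /(ler_wpM2l (W0 i j)).
  by rewrite mulrCA mulrDr => ?; lra.
under [leRHS]eq_bigr do rewrite big_split /= -!mulr_sumr.
rewrite big_split /= -!mulr_sumr weighted_rows_sum// weighted_cols_sum//.
move=> /(ler_wpM2l (ltW c0)).
rewrite -gossip_sqrt_sq; have := frob_sq_ge0 A; nra.
Qed.

(** If the Dirichlet form vanishes, so does each of its nonnegative terms. Edges have positive
    weight, hence rows agree along edges and, by connectedness, everywhere. *)
Lemma gossip_sqrt_ker (d : nat) (A : 'M[R]_(m, d)) :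
  L *m A = 0 <-> forall i j, row i A = row j A.
Proof.
have [c0 c12] := andP c_bounds.
have [_ [W0 _ _] _ Wpos _] := Wt_gossip; have [_ conn] := e_conn.
split => [LA i j|rowA]; last first.
  apply: frob_sq_le0; rewrite -(pmulr_rle0 _ (ltr0Sn R 1)) gossip_sqrt_sq.
  rewrite big1 ?mulr0// => i _; rewrite big1// => j _.
  by rewrite (rowA i j) subrr /frob_sq frob_dot0l mulr0.
have term0 k l : 0 <= Wt k l * frob_sq (row k A - row l A).
  by rewrite mulr_ge0// frob_sq_ge0.
have edge k l : e k l -> row k A = row l A.
  move=> ekl; apply/subr0_eq/frob_sq_le0.
  rewrite -(pmulr_rle0 _ (Wpos _ _ ekl)) -(pmulr_rle0 _ c0).
  have -> : 0 = c * \sum_(i < m) \sum_(j < m) Wt i j * frob_sq (row i A - row j A).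
    by rewrite -gossip_sqrt_sq LA /frob_sq frob_dot0l mulr0.
  rewrite ler_pM2l// (bigD1 k)//= (bigD1 l)//= -addrA lerDl addr_ge0//.
    by apply: sumr_ge0.
  by apply: sumr_ge0 => ? _; apply: sumr_ge0.
have /connectP[s es ->] := conn i j.
elim: s i es => //= k s IH i /andP[eik eks].
by rewrite (edge _ _ eik); exact: IH.
Qed.

(* Range of a symmetric matrix = orthogonal complement of its kernel, the
   kernel consisting here of the consensual vectors. *)
Lemma gossip_sqrt_range (d : nat) (B : 'M[R]_(m, d)) :
  (forall j, \sum_i B i j = 0) -> exists Y, L *m Y = B.
Proof.
move=> B0; have /submxP[D BD] : (B^T <= L)%MS.
  rewrite submxE; apply/eqP/matrixP => j k; rewrite !mxE.
  (* The columns of [cokermx L] lie in the kernel of [L], so they are constant, and multiplying by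
     [B^T] yields column sums of [B]. *)
  have kerC := (gossip_sqrt_ker (cokermx L)).1 (mulmx_coker L).
  have rowC i l : cokermx L i k = cokermx L l k.
    by have /rowP/(_ k) := kerC i l; rewrite !mxE.
  have [i0 _|noi] := pickP (@predT 'I_m); last first.
    by rewrite big1// => i _; have := noi i.
  under eq_bigr do rewrite mxE (rowC _ i0).
  by rewrite -mulr_suml B0 mul0r.
by exists D^T; rewrite -{1}LT -trmx_mul -BD trmxK.
Qed.

End GossipSquareRoot.

(** * First-order optimality, the stepsize rule, small quantities *)

Lemma grad_sum_min {R : realType} (m d : nat) (f : 'I_m -> 'rV[R]_d -> R) xmin :
  (forall i, differentiable (f i) xmin) ->
  (forall x, \sum_i f i xmin <= \sum_i f i x) -> \sum_i grad (f i) xmin = 0.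
Proof.
move=> fd fmin; set G := \sum_i _.
have derG : derivable (\sum_i f i) xmin (- G).
  by apply: derivable_sum => i; exact: diff_derivable.
(* The derivative of the sum in the direction [- G] is [- frob_sq G], and minimality makes it
   nonnegative. *)
apply: frob_sq_le0; rewrite -oppr_ge0 /frob_sq -frob_dotNr {1}/G frob_dot_suml.
under eq_bigr do rewrite -grad_dotE//.
rewrite -derive_sum; last by move=> i; exact: diff_derivable.
have /cvg_dnbhs_at_right/cvgr_to_ge := derG; apply.
near=> h.
have h0 : 0 < h by near: h; exact: nbhs_right_gt.
by rewrite -[_ *: _]/(_ * _) mulr_ge0 ?invr_ge0 ?(ltW h0)// subr_ge0 !fct_sumE/= fmin.
Unshelve. all: by end_near. Qed.

Lemma sumF_grad_ineq {R : realType} (m d : nat) (f : 'I_m -> 'rV[R]_d -> R)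
    (X Z : 'M[R]_(m, d)) :
  (forall i, continuously_differentiable (f i)) ->
  (forall i, convex_on_space (f i)) ->
  sumF f X + frob_dot (gradF f X) (Z - X) <= sumF f Z.
Proof.
move=> fC1 fconv; rewrite frob_dot_rows -big_split; apply: ler_sum => i _ /=.
have -> : row i (gradF f X) = grad (f i) (row i X) by apply/rowP => j; rewrite !mxE.
by rewrite linearB /= convex_grad_ineq//; case: (fC1 i).
Qed.

Lemma stepsize_bounds {R : realType} (c1 c2 l s gp ap : R) (pik : R -> R) :
  0 < c1 -> 0 < c2 -> 0 <= l -> 0 < s -> 0 < gp -> 0 < ap -> ap <= pik ap ->
  let a := stepsize c1 c2 l s gp ap pik in
  [/\ 0 < a, 2 * a * l + 2 * s * a ^+ 2 / c1 <= 1,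
      a ^+ 2 <= (1 + c2 * gp) * ap ^+ 2 &
      forall K sb, l <= K -> s <= sb ->
        Num.min (Num.sqrt (K ^+ 2 + 2 * sb / c1) + K)^-1 ap <= a].
Proof.
move=> c10 c20 l0 s0 gp0 ap0 piap /=.
pose S t r : R := Num.sqrt (t ^+ 2 + 2 * r / c1) + t.
have S0 t r : 0 <= t -> 0 < r -> 0 < S t r.
  move=> t0 r0; rewrite ltr_pwDl// sqrtr_gt0 ltr_wpDl ?sqr_ge0//.
  by rewrite divr_gt0// mulr_gt0.
have growth1 : 1 <= Num.sqrt (1 + c2 * gp).
  by rewrite -[leLHS]sqrtr1 ler_wsqrtr// lerDl mulr_ge0 ?ltW.
have apg : ap <= Num.sqrt (1 + c2 * gp) * ap by rewrite ler_peMl// ltW.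
have a0 : 0 < stepsize c1 c2 l s gp ap pik.
  by rewrite /stepsize !lt_min invr_gt0 (S0 _ _ l0 s0) !(lt_le_trans ap0).
split => //.
- have : stepsize c1 c2 l s gp ap pik <= (S l s)^-1 by rewrite /stepsize ge_min lexx.
  move: (stepsize _ _ _ _ _ _ _) a0 => a a0 aS.
  (* Isolating the root before squaring makes [l ^+ 2] cancel, which leaves exactly the claimed
     inequality after multiplication by [a ^+ 2]. *)
  have Sa : Num.sqrt (l ^+ 2 + 2 * s / c1) <= a^-1 - l.
    by rewrite lerBrDr -[leLHS]invrK lef_pV2// posrE invr_gt0 S0.
  have : l ^+ 2 + 2 * s / c1 <= (a^-1 - l) ^+ 2.
    rewrite -[leLHS]sqr_sqrtr; last first.
      by rewrite addr_ge0 ?sqr_ge0// divr_ge0 ?mulr_ge0 ?ltW.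
    by rewrite lerXn2r// nnegrE ?sqrtr_ge0// (le_trans (sqrtr_ge0 _) Sa).
  rewrite -(ler_pM2r (exprn_gt0 2 a0)).
  have -> : (a^-1 - l) ^+ 2 * a ^+ 2 = 1 - 2 * a * l + l ^+ 2 * a ^+ 2.
    by field; rewrite gt_eqF.
  have -> : 2 * s * a ^+ 2 / c1 = 2 * s / c1 * a ^+ 2 by ring.
  by move=> ?; lra.
- have : stepsize c1 c2 l s gp ap pik <= Num.sqrt (1 + c2 * gp) * ap.
    by rewrite /stepsize !ge_min lexx orbT.
  move: (stepsize _ _ _ _ _ _ _) a0 => a a0.
  move/(lerXn2r 2); rewrite !nnegrE => /(_ (ltW a0) _).
  rewrite exprMn sqr_sqrtr; last by rewrite addr_ge0// mulr_ge0 ?ltW.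
  by apply; rewrite mulr_ge0 ?sqrtr_ge0 ?ltW.
- move=> K sb lK ssb.
  (* The last two arguments of the minimum are at least [ap], so only the first can push the
     stepsize below [ap], and it is antitone in [l] and [s]. *)
  have K0 := le_trans l0 lK; have sb0 := lt_le_trans s0 ssb.
  rewrite /stepsize !le_min !ge_min apg piap !orbT andbT/=.
  rewrite lef_pV2 ?posrE ?S0// lerD// ler_wsqrtr// lerD//.
    by rewrite lerXn2r// nnegrE.
  by rewrite ler_pM2r ?invr_gt0// ler_pM2l.
Qed.

Lemma summable_small {R : realType} (u : nat -> R) (B : R) :
  (forall n, 0 <= u n) -> (forall n, \sum_(0 <= k < n) u k <= B) ->
  forall eps, 0 < eps -> exists N, forall n, (N <= n)%N -> u n < eps.
Proof.
move=> u0 uB eps eps0.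
have /cvg_series_cvg_0/cvgrPdist_lt/(_ _ eps0)[N _ NP] : cvgn (series u).
  apply: nondecreasing_is_cvgn; first exact: nondecreasing_series.
  by exists B => _ [n _ <-]; exact: uB.
by exists N => n /NP; rewrite sub0r normrN ger0_norm.
Qed.

Lemma le0_of_small {R : realType} (t C : R) : 0 <= C ->
  (forall eps, 0 < eps -> t <= C * eps) -> t <= 0.
Proof.
move=> C0 tC; rewrite leNgt; apply/negP => t0.
have C1 : 0 < C + 1 by rewrite ltr_wpDl.
have := tC _ (divr_gt0 t0 C1); rewrite mulrA ler_pdivlMr//; lra.
Qed.

(** * Adaptive primal-dual iterations *)

Section AdaptivePrimalDual.
Context {R : realType} {m d : nat}.
Variables (F : 'M[R]_(m, d) -> R) (G : 'M[R]_(m, d) -> 'M[R]_(m, d)).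
Variables (L : 'M[R]_m) (c1 c2 sbar : R) (sigma alpha gamma l : nat -> R).
Variables (X Y : nat -> 'M[R]_(m, d)).
Hypothesis grad_ineq : forall A B, F A + frob_dot (G A) (B - A) <= F B.
Hypothesis grad_lip : forall B, exists2 K, 0 < K &
  frob_lipschitz K [set A | frob_sq A <= B] G.
Hypothesis LT : L^T = L.
Hypothesis L_contract : forall A : 'M[R]_(m, d), frob_sq (L *m A) <= frob_sq A.
Hypothesis c1_bounds : 0 < c1 < 1.
Hypothesis c2_bounds : 0 < c2 <= 1.
Hypothesis sigma_mono : forall j k : nat, (j <= k)%N -> sigma j <= sigma k.
Hypothesis sigma_bounds : forall k, 0 < sigma k <= sbar.
Hypothesis alpha_gt0 : forall k, 0 < alpha k.
Hypothesis gamma0 : gamma 0%N = 1.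
Hypothesis gammaS : forall k, gamma k.+1 = alpha k.+1 / alpha k.
Hypothesis l_ge0 : forall k, 0 <= l k.
Hypothesis l_lip : forall k,
  frob_sq (G (X k.+1) - G (X k)) <= l k ^+ 2 * frob_sq (X k.+1 - X k).
Hypothesis l_least : forall k K, 0 <= K ->
  frob_norm (G (X k.+1) - G (X k)) <= K * frob_norm (X k.+1 - X k) -> l k <= K.
Hypothesis alpha_step : forall k,
  2 * alpha k.+1 * l k + 2 * sigma k.+1 * alpha k.+1 ^+ 2 / c1 <= 1.
Hypothesis alpha_growth : forall k,
  alpha k.+1 ^+ 2 <= (1 + c2 * gamma k) * alpha k ^+ 2.
Hypothesis alpha_lower : forall k K, l k <= K ->
  Num.min (Num.sqrt (K ^+ 2 + 2 * sbar / c1) + K)^-1 (alpha k) <= alpha k.+1.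
Hypothesis X_rec : forall k,
  X k.+1 = X k - alpha k *: (G (X k) + L *m Y k.+1).
(* The first update is left out: the increment of the initial pair of points is
   arbitrary, not a gradient step as [energy_step] requires. *)
Hypothesis Y_rec : forall k, Y k.+2 = Y k.+1 + (sigma k.+1 * alpha k.+1) *:
  ((1 + gamma k.+1) *: (L *m X k.+1) - gamma k.+1 *: (L *m X k)).

Let dX k := frob_sq (X k.+1 - X k).
Let dY k := frob_sq (Y k.+2 - Y k.+1).

Lemma gamma_gt0 k : 0 < gamma k.
Proof. by case: k => [|k]; rewrite ?gamma0// gammaS divr_gt0. Qed.

Definition kkt (Xs Ys : 'M[R]_(m, d)) := L *m Xs = 0 /\ G Xs + L *m Ys = 0.

(** For a [kkt] pair, [L Ys] is minus the gradient at [Xs], so this is the Bregman distance of [F]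
    from [Xs] to [A]. *)
Definition gap (Xs Ys A : 'M[R]_(m, d)) :=
  F A - F Xs + frob_dot (L *m Ys) (A - Xs).

Definition energy (Xs Ys : 'M[R]_(m, d)) k :=
  frob_sq (X k.+1 - Xs) + frob_sq (Y k.+1 - Ys) / sigma k + dX k / 2 +
  2 * alpha k * (1 + gamma k) * gap Xs Ys (X k).

(** The first two terms are the losses in [energy_step]; the third is the slack between
    [1 + gamma k] and the growth factor [1 + c2 * gamma k]. *)
Definition decrease (Xs Ys : 'M[R]_(m, d)) k :=
  (1 - c1) / sigma k.+1 * dY k + sigma k.+1 * alpha k.+1 ^+ 2 / c1 * dX k +
  2 * (1 - c2) * gamma k * alpha k * gap Xs Ys (X k).

Lemma gap_ge0 Xs Ys A : kkt Xs Ys -> 0 <= gap Xs Ys A.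
Proof.
move=> [_ /eqP]; rewrite addrC addr_eq0 => /eqP LYs.
by rewrite /gap LYs frob_dotNl; have := grad_ineq Xs A; lra.
Qed.

Lemma energy_decrease Xs Ys k : kkt Xs Ys ->
  energy Xs Ys k.+1 <= energy Xs Ys k - decrease Xs Ys k.
Proof.
move=> kktP; have [LXs _] := kktP.
have [c10 _] := andP c1_bounds; have [s0 _] := andP (sigma_bounds k.+1).
have [sk0 _] := andP (sigma_bounds k).
have := energy_step Ys LT L_contract (alpha_gt0 k) s0 c10 (l_ge0 k)
  (alpha_gt0 k.+1) (gammaS k) (alpha_step k) (X_rec k.+1) (X_rec k) (Y_rec k)
  (l_lip k) (grad_ineq _ Xs) (grad_ineq _ _) LXs.
rewrite -/(gap Xs Ys (X k.+1)) -/(gap Xs Ys (X k)) -/(dX k) -/(dX k.+1) -/(dY k).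
(* Monotonicity of [sigma] lets the dual terms telescope despite their changing weight. *)
have Ysig : frob_sq (Y k.+1 - Ys) / sigma k.+1 <= frob_sq (Y k.+1 - Ys) / sigma k.
  by rewrite ler_wpM2l ?frob_sq_ge0// lef_pV2 ?posrE// sigma_mono.
have alg : alpha k.+1 * gamma k.+1 <= (1 + c2 * gamma k) * alpha k.
  by rewrite gammaS mulrA ler_pdivrMr// -mulrA -!expr2.
have := ler_wpM2r (gap_ge0 (X k) kktP) alg.
rewrite /energy /decrease; lra.
Qed.

Lemma decrease_ge Xs Ys k : kkt Xs Ys ->
  (1 - c1) / sbar * dY k + sigma 0%N * alpha k.+1 ^+ 2 / c1 * dX k <=
  decrease Xs Ys k.
Proof.
move=> kktP; have [c10 c11] := andP c1_bounds; have [_ c21] := andP c2_bounds.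
have [s0 sb] := andP (sigma_bounds k.+1).
rewrite /decrease -[leLHS]addr0; apply: lerD; first apply: lerD.
- rewrite ler_wpM2r ?frob_sq_ge0// ler_wpM2l ?subr_ge0 ?(ltW c11)//.
  by rewrite lef_pV2 ?posrE// (lt_le_trans s0).
- rewrite ler_wpM2r ?frob_sq_ge0// ler_wpM2r ?invr_ge0 ?(ltW c10)//.
  by rewrite ler_wpM2r ?sqr_ge0// sigma_mono.
- by rewrite !mulr_ge0 ?gap_ge0// ?subr_ge0// ltW ?gamma_gt0.
Qed.

Lemma decrease_ge0 Xs Ys k : kkt Xs Ys -> 0 <= decrease Xs Ys k.
Proof.
move=> kktP; apply: le_trans (decrease_ge k kktP).
have [c10 c11] := andP c1_bounds.
have [s0 _] := andP (sigma_bounds 0); have sb : 0 < sbar.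
  by have [s1 s1b] := andP (sigma_bounds 0); exact: lt_le_trans s1b.
by rewrite addr_ge0// mulr_ge0 ?frob_sq_ge0 ?divr_ge0 ?mulr_ge0 ?sqr_ge0 ?subr_ge0 ?ltW.
Qed.

Lemma energy_sum Xs Ys n : kkt Xs Ys ->
  energy Xs Ys n + \sum_(0 <= k < n) decrease Xs Ys k <= energy Xs Ys 0.
Proof.
move=> kktP; elim: n => [|n IH]; first by rewrite big_nil addr0.
rewrite big_nat_recr//=; have := energy_decrease n kktP; lra.
Qed.

Lemma energy_ge Xs Ys k : kkt Xs Ys ->
  frob_sq (X k.+1 - Xs) + frob_sq (Y k.+1 - Ys) / sbar <= energy Xs Ys k.
Proof.
move=> kktP; have [s0 sb] := andP (sigma_bounds k).
apply: ler_wpDr; first by rewrite !mulr_ge0 ?gap_ge0// ?addr_ge0// ltW ?gamma_gt0.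
apply: ler_wpDr; first by rewrite divr_ge0// frob_sq_ge0.
rewrite lerD2l ler_wpM2l ?frob_sq_ge0//.
by rewrite lef_pV2 ?posrE// (lt_le_trans s0).
Qed.

Lemma energy_mono Xs Ys j k : kkt Xs Ys -> (j <= k)%N ->
  energy Xs Ys k <= energy Xs Ys j.
Proof.
move=> kktP /subnK <-; elim: (k - j)%N => // n; apply: le_trans.
have := energy_decrease (n + j) kktP; have := decrease_ge0 (n + j) kktP.
by rewrite addSn; lra.
Qed.

Lemma decrease_sum Xs Ys n : kkt Xs Ys ->
  \sum_(0 <= k < n) decrease Xs Ys k <= energy Xs Ys 0.
Proof.
move=> kktP; have := energy_sum n kktP; have := energy_ge n kktP.
have [s1 s1b] := andP (sigma_bounds 0).
have : 0 <= frob_sq (X n.+1 - Xs) + frob_sq (Y n.+1 - Ys) / sbar.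
  by rewrite addr_ge0 ?divr_ge0 ?frob_sq_ge0// (le_trans (ltW s1) s1b).
lra.
Qed.

(** * Boundedness, residuals and summable increments *)

Hypothesis kkt_exists : exists Xs Ys, kkt Xs Ys.

Lemma iterates_bounded : exists B,
  (forall k, frob_sq (X k) <= B) /\ (forall k, frob_sq (Y k) <= B).
Proof.
have [Xs [Ys kktP]] := kkt_exists.
have [s1 s1b] := andP (sigma_bounds 0); have sb := lt_le_trans s1 s1b.
pose E0 := energy Xs Ys 0.
have bnd k : frob_sq (X k.+1) + frob_sq (Y k.+1) <=
    2 * (1 + sbar) * E0 + 2 * (frob_sq Xs + frob_sq Ys).
  have := frob_sqD_le (X k.+1 - Xs) Xs; have := frob_sqD_le (Y k.+1 - Ys) Ys.
  rewrite !subrK.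
  have := le_trans (energy_ge k kktP) (energy_mono kktP (leq0n k)).
  rewrite -/E0; set u := frob_sq _; set v := frob_sq (Y _ - _).
  have u0 : 0 <= u := frob_sq_ge0 _; have v0 : 0 <= v := frob_sq_ge0 _.
  (* The energy controls only [v / sbar]; multiplying back by [sbar] produces the factor
     [1 + sbar]. *)
  have vE : v / sbar * sbar = v by rewrite divfK// gt_eqF.
  have w0 : 0 <= v / sbar by rewrite divr_ge0// ltW.
  rewrite -{2}vE; move: (v / sbar) w0 => w w0 uw.
  have : u * sbar + w * sbar <= E0 * sbar by rewrite -mulrDl ler_wpM2r// ltW.
  have : 0 <= u * sbar by rewrite mulr_ge0// ltW.
  lra.
pose B := 2 * (1 + sbar) * E0 + 2 * (frob_sq Xs + frob_sq Ys).
have B0 : 0 <= B.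
  by apply: le_trans (bnd 0); rewrite addr_ge0 ?frob_sq_ge0.
(* The energy sees the iterates from index 1 on, so index 0 is added by hand. *)
exists (B + frob_sq (X 0) + frob_sq (Y 0)); split => -[|k].
- by have := frob_sq_ge0 (Y 0); lra.
- have := frob_sq_ge0 (Y 0); have := frob_sq_ge0 (X 0).
  by have := frob_sq_ge0 (Y k.+1); have := bnd k; rewrite -/B; lra.
- by have := frob_sq_ge0 (X 0); lra.
- have := frob_sq_ge0 (Y 0); have := frob_sq_ge0 (X 0).
  by have := frob_sq_ge0 (X k.+1); have := bnd k; rewrite -/B; lra.
Qed.

(** Below: on the ball containing the iterates [l k] is at most a fixed [K], and [alpha_lower]
    propagates a constant bound by induction. Above: [alpha_step] bounds the square of each later
    stepsize, and a number is at most 1 plus its square; [alpha 0] is arbitrary and is added. *)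
Lemma alpha_bounded : exists amin amax, [/\ 0 < amin, 0 < amax &
  forall k, amin <= alpha k <= amax].
Proof.
have [B [XB _]] := iterates_bounded; have [K K0 KP] := grad_lip B.
have [c10 _] := andP c1_bounds; have [s0 s0b] := andP (sigma_bounds 0).
pose low := Num.min (Num.sqrt (K ^+ 2 + 2 * sbar / c1) + K)^-1 (alpha 0).
exists low, (alpha 0 + (1 + c1 / (2 * sigma 0))); split.
- rewrite lt_min alpha_gt0 andbT invr_gt0 ltr_wpDl ?sqrtr_ge0//.
- by rewrite addr_gt0// addr_gt0// divr_gt0// mulr_gt0.
move=> k; apply/andP; split.
  elim: k => [|k IH]; first by rewrite ge_min lexx orbT.
  have lK : l k <= K by apply: l_least; [exact: ltW | apply: KP; exact: XB].
  apply: le_trans (alpha_lower lK); rewrite le_min IH andbT.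
  by rewrite ge_min lexx.
case: k => [|k]; first by rewrite lerDl addr_ge0// divr_ge0 ?mulr_ge0 ?ltW.
apply: (@le_trans _ _ (1 + c1 / (2 * sigma 0))); last by rewrite lerDr ltW.
have asq : alpha k.+1 ^+ 2 <= c1 / (2 * sigma 0).
  rewrite ler_pdivlMr ?mulr_gt0//.
  have : 2 * sigma k.+1 * alpha k.+1 ^+ 2 / c1 <= 1.
    apply: le_trans (alpha_step k); rewrite lerDr mulr_ge0//.
    by rewrite mulr_ge0// ltW.
  rewrite ler_pdivrMr// mul1r; apply: le_trans.
  by rewrite mulrC ler_wpM2r ?sqr_ge0// ler_wpM2l// sigma_mono.
have := sqr_ge0 (alpha k.+1 - 1); have := alpha_gt0 k.+1; nra.
Qed.

Lemma gamma_bounded : exists gmin gmax, [/\ 0 < gmin, 0 < gmax &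
  forall k, gmin <= gamma k <= gmax].
Proof.
have [amin [amax [amin0 amax0 aP]]] := alpha_bounded.
have amm : amin <= amax by have /andP[h] := aP 0; exact: le_trans.
exists (amin / amax), (amax / amin); split; rewrite ?divr_gt0// => -[|k].
  by rewrite gamma0 ler_pdivrMr// mul1r ler_pdivlMr// mul1r amm.
have /andP[a1 a2] := aP k; have /andP[b1 b2] := aP k.+1.
rewrite gammaS; apply/andP; split.
  by rewrite ler_pM ?invr_ge0 ?(ltW amin0) ?(ltW amax0)// lef_pV2 ?posrE.
by rewrite ler_pM ?invr_ge0 ?(ltW amin0) ?(ltW (alpha_gt0 _))// lef_pV2 ?posrE.
Qed.

(** The strict inequality [c1 < 1] keeps the coefficient of [dY] in [decrease] positive, and the
    lower bound on the stepsizes keeps that of [dX] away from 0. *)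
Lemma increments_le : exists2 C, 0 < C & forall Xs Ys, kkt Xs Ys -> forall k,
  dX k + dY k <= C * decrease Xs Ys k.
Proof.
have [amin [amax [amin0 amax0 aP]]] := alpha_bounded.
have [c10 c11] := andP c1_bounds; have [s0 s0b] := andP (sigma_bounds 0).
have sb := lt_le_trans s0 s0b.
pose u := (1 - c1) / sbar; pose v := sigma 0 * amin ^+ 2 / c1.
have u0 : 0 < u by rewrite divr_gt0 ?subr_gt0.
have v0 : 0 < v by rewrite divr_gt0// mulr_gt0// exprn_gt0.
exists (u^-1 + v^-1); first by rewrite addr_gt0 ?invr_gt0.
move=> Xs Ys kktP k.
have X0 : 0 <= dX k := frob_sq_ge0 _; have Y0 : 0 <= dY k := frob_sq_ge0 _.
have : u * dY k + v * dX k <= decrease Xs Ys k.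
  apply: le_trans (decrease_ge k kktP); rewrite lerD2l ler_wpM2r//.
  rewrite ler_wpM2r ?invr_ge0 ?(ltW c10)// ler_wpM2l ?(ltW s0)//.
  by have /andP[a1 _] := aP k.+1; rewrite lerXn2r// nnegrE ltW.
move: (decrease _ _ _) => D uvD.
have : u * dY k <= D by have := mulr_ge0 (ltW v0) X0; lra.
have : v * dX k <= D by have := mulr_ge0 (ltW u0) Y0; lra.
rewrite -!ler_pdivlMl// => ? ?; rewrite mulrDl addrC; exact: lerD.
Qed.

(** The dual update is solved for [L X]: what remains is a dual increment over [sigma * alpha] and
    an extrapolation term, both with bounded coefficients. *)
Lemma consensus_residual : exists2 C, 0 < C & forall k,
  frob_sq (L *m X k.+1) <= C * (dX k + dY k).
Proof.
have [amin [amax [amin0 amax0 aP]]] := alpha_bounded.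
have [gmin [gmax [gmin0 gmax0 gP]]] := gamma_bounded.
have [s0 s0b] := andP (sigma_bounds 0).
pose t := (sigma 0 * amin)^-1.
have t0 : 0 < t by rewrite invr_gt0 mulr_gt0.
exists (2 * (t ^+ 2 + gmax ^+ 2)).
  by rewrite mulr_gt0// addr_gt0// exprn_gt0.
move=> k; pose sa := sigma k.+1 * alpha k.+1.
have sk0 : 0 < sigma k.+1 by have /andP[] := sigma_bounds k.+1.
have sa0 : 0 < sa by rewrite mulr_gt0.
have -> : L *m X k.+1 = sa^-1 *: (Y k.+2 - Y k.+1)
    + - (gamma k.+1 *: (L *m (X k.+1 - X k))).
  rewrite Y_rec addrAC subrr add0r scalerA mulVf ?gt_eqF// scale1r.
  by rewrite scalerDl scale1r -(addrA (L *m X k.+1)) -scalerBr -mulmxBr addrK.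
apply: le_trans (frob_sqD_le _ _) _; rewrite -mulrA ler_pM2l// frob_sqN !frob_sqZ.
have /andP[a1 _] := aP k.+1; have /andP[_ g2] := gP k.+1.
have X0 : 0 <= dX k := frob_sq_ge0 _; have Y0 : 0 <= dY k := frob_sq_ge0 _.
have sat : sa^-1 ^+ 2 <= t ^+ 2.
  rewrite lerXn2r ?nnegrE ?(ltW t0) ?invr_ge0 ?(ltW sa0)//.
  rewrite lef_pV2 ?posrE ?mulr_gt0// ler_pM ?(ltW s0) ?(ltW amin0)//.
  exact: sigma_mono.
have gg : gamma k.+1 ^+ 2 <= gmax ^+ 2.
  by rewrite lerXn2r ?nnegrE ?(ltW gmax0) ?(ltW (gamma_gt0 _)).
have := ler_wpM2r Y0 sat; have := ler_wpM2r X0 gg.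
have := ler_wpM2l (sqr_ge0 (gamma k.+1)) (L_contract (X k.+1 - X k)).
have := mulr_ge0 (sqr_ge0 t) X0; have := mulr_ge0 (sqr_ge0 gmax) Y0.
rewrite -/(dX k) -/(dY k); lra.
Qed.

(** The primal update is solved for the gradient plus the new dual term; going back to the dual
    iterate of the same index costs one dual increment. *)
Lemma gradient_residual : exists2 C, 0 < C & forall k,
  frob_sq (G (X k.+1) + L *m Y k.+1) <= C * (dX k.+1 + dY k).
Proof.
have [amin [amax [amin0 amax0 aP]]] := alpha_bounded.
pose t := amin^-1; have t0 : 0 < t by rewrite invr_gt0.
exists (2 * (t ^+ 2 + 1)); first by rewrite mulr_gt0// addr_gt0// exprn_gt0.
move=> k; have -> : G (X k.+1) + L *m Y k.+1 =
    - ((alpha k.+1)^-1 *: (X k.+2 - X k.+1)) + - (L *m (Y k.+2 - Y k.+1)).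
  have -> : X k.+2 - X k.+1 = - (alpha k.+1 *: (G (X k.+1) + L *m Y k.+2)).
    by rewrite X_rec addrC addKr.
  rewrite scalerN opprK scalerA mulVf ?gt_eqF//.
  by rewrite scale1r mulmxBr opprB -addrA subrKC.
apply: le_trans (frob_sqD_le _ _) _; rewrite -mulrA ler_pM2l// !frob_sqN frob_sqZ.
have X0 : 0 <= dX k.+1 := frob_sq_ge0 _; have Y0 : 0 <= dY k := frob_sq_ge0 _.
have at2 : (alpha k.+1)^-1 ^+ 2 <= t ^+ 2.
  rewrite lerXn2r ?nnegrE ?(ltW t0) ?invr_ge0 ?(ltW (alpha_gt0 _))//.
  by rewrite lef_pV2 ?posrE//; case/andP: (aP k.+1).
have := ler_wpM2r X0 at2; have := L_contract (Y k.+2 - Y k.+1).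
have := mulr_ge0 (sqr_ge0 t) Y0.
rewrite -/(dX k.+1) -/(dY k); lra.
Qed.

(** * Convergence of the whole sequence *)

Lemma increments_small eps : 0 < eps ->
  exists N, forall n, (N <= n)%N -> dX n + dY n < eps.
Proof.
have [Xs [Ys kktP]] := kkt_exists; have [C C0 CP] := increments_le.
apply: (@summable_small _ _ (C * energy Xs Ys 0)).
  by move=> n; rewrite addr_ge0 ?frob_sq_ge0.
move=> n; apply: (@le_trans _ _ (\sum_(0 <= k < n) C * decrease Xs Ys k)).
  by apply: ler_sum => k _; exact: CP.
by rewrite -mulr_sumr ler_pM2l// decrease_sum.
Qed.

Lemma kkt_cluster : exists Xs Ys, kkt Xs Ys /\
  forall eps N, 0 < eps -> exists2 n, (N <= n)%N &
    frob_sq (X n.+1 - Xs) + frob_sq (Y n.+1 - Ys) < eps.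
Proof.
have [B [XB YB]] := iterates_bounded.
have [Xs [Ys clust]] := bounded_pair_cluster
  (fun n => XB n.+1) (fun n => YB n.+1).
exists Xs, Ys; split => //.
have XsB : frob_sq Xs <= 2 * (B + 1).
  have [n _ nP] := clust 1 0 ltr01.
  have := frob_sqD_le (X n.+1) (Xs - X n.+1); rewrite subrKC frob_sqBC.
  have := XB n.+1; have := frob_sq_ge0 (Y n.+1 - Ys); lra.
(* This ball contains both the iterates and the cluster point, so [G] can be compared between
   them. *)
have [K K0 KP] := grad_lip (2 * (B + 1)).
have XB2 k : frob_sq (X k) <= 2 * (B + 1).
  by have := XB k; have := frob_sq_ge0 (X k); lra.
have [C1 C10 C1P] := consensus_residual.
have [C2 C20 C2P] := gradient_residual.
(* Two consecutive increments are needed because the gradient residual at [n] involves [dX n.+1]. *)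
have close eps : 0 < eps -> exists n, [/\ dX n + dY n < eps, dX n.+1 + dY n.+1 < eps,
    frob_sq (X n.+1 - Xs) < eps & frob_sq (Y n.+1 - Ys) < eps].
  move=> eps0; have [N NP] := increments_small eps0.
  have [n Nn nP] := clust eps N eps0; exists n.
  have := frob_sq_ge0 (X n.+1 - Xs); have := frob_sq_ge0 (Y n.+1 - Ys).
  by split; [exact: NP|apply: NP; exact: leqW|lra|lra].
split; apply: frob_sq_le0.
- apply: (@le0_of_small _ _ (2 * (C1 + 1))) => [|eps eps0].
    by rewrite mulr_ge0// addr_ge0// ltW.
  have [n [n1 _ n2 _]] := close _ eps0.
  have -> : L *m Xs = L *m X n.+1 + L *m (Xs - X n.+1) by rewrite mulmxBr subrKC.
  apply: le_trans (frob_sqD_le _ _) _.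
  have := L_contract (Xs - X n.+1); rewrite (frob_sqBC Xs).
  have := C1P n; have := ler_wpM2l (ltW C10) (ltW n1); lra.
- apply: (@le0_of_small _ _ (2 * (C2 * 2 + 2 * (K ^+ 2 + 1)))) => [|eps eps0].
    by have := sqr_ge0 K; lra.
  have [n [n1 n1' n2 n3]] := close _ eps0.
  have -> : G Xs + L *m Ys = (G (X n.+1) + L *m Y n.+1)
      + ((G Xs - G (X n.+1)) + L *m (Ys - Y n.+1)).
    by rewrite mulmxBr addrACA !subrKC.
  apply: le_trans (frob_sqD_le _ _) _.
  have := frob_sqD_le (G Xs - G (X n.+1)) (L *m (Ys - Y n.+1)).
  have := L_contract (Ys - Y n.+1); rewrite (frob_sqBC Ys).
  have := frob_sq_lipschitz KP XsB (XB2 n.+1); rewrite (frob_sqBC Xs).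
  have := C2P n.
  have : dX n.+1 + dY n <= 2 * eps.
    have : 0 <= dX n := frob_sq_ge0 _.
    have : 0 <= dY n.+1 := frob_sq_ge0 _; lra.
  move/(ler_wpM2l (ltW C20)); have := ler_wpM2l (sqr_ge0 K) (ltW n2).
  lra.
Qed.

(** The gradient inequality at [A] bounds the Bregman distance by the product of [G A - G Xs] with
    [A - Xs]. This makes the [gap] term of the energy vanish as the iterates approach [Xs]. *)
Lemma gap_le_sq Xs Ys A B K : kkt Xs Ys -> 0 <= K ->
  frob_lipschitz K [set Z | frob_sq Z <= B] G ->
  frob_sq Xs <= B -> frob_sq A <= B -> gap Xs Ys A <= K * frob_sq (A - Xs).
Proof.
move=> [_ /eqP]; rewrite addrC addr_eq0 => /eqP LYs K0 KP XsB AB.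
have := frob_dot_lip (A - Xs) K0 (frob_sq_lipschitz KP AB XsB).
rewrite /gap LYs frob_dotNl frob_dotBl; have := grad_ineq A Xs.
by rewrite -[Xs - A]opprB frob_dotNr; lra.
Qed.

Lemma iterates_converge : exists Xs Ys, kkt Xs Ys /\
  forall eps, 0 < eps -> exists N, forall n, (N <= n)%N ->
    frob_sq (X n - Xs) < eps /\ frob_sq (Y n - Ys) < eps.
Proof.
have [Xs [Ys [kktP clust]]] := kkt_cluster.
exists Xs, Ys; split => // eps eps0.
have [B [XB _]] := iterates_bounded.
have [K K0 KP] := grad_lip (B + frob_sq Xs).
have XsB : frob_sq Xs <= B + frob_sq Xs.
  by have := le_trans (frob_sq_ge0 _) (XB 0); lra.
have XB' k : frob_sq (X k) <= B + frob_sq Xs.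
  by have := XB k; have := frob_sq_ge0 Xs; lra.
have [amin [amax [amin0 amax0 aP]]] := alpha_bounded.
have [gmin [gmax [gmin0 gmax0 gP]]] := gamma_bounded.
have [s0 s0b] := andP (sigma_bounds 0); have sb := lt_le_trans s0 s0b.
pose M := 2 * amax * (1 + gmax).
have M0 : 0 < M by rewrite mulr_gt0 ?addr_gt0// mulr_gt0.
(* The energy relative to the cluster pair is bounded by quantities that are all small at some late
   index; monotonicity of the energy then covers every later index. *)
have energy_le k : energy Xs Ys k <= frob_sq (X k.+1 - Xs) +
    (sigma 0)^-1 * frob_sq (Y k.+1 - Ys) + dX k +
    M * K * (2 * (frob_sq (X k.+1 - Xs) + dX k)).
  rewrite /energy; have dX0 : 0 <= dX k := frob_sq_ge0 _.
  have := gap_le_sq kktP (ltW K0) KP XsB (XB' k).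
  have := frob_sqD_le (X k.+1 - Xs) (X k - X k.+1).
  rewrite addrC subrKA (frob_sqBC (X k)) -/(dX k) => h1 h2.
  have g0 := gap_ge0 (X k) kktP.
  have /andP[_ a2] := aP k; have /andP[_ g2] := gP k.
  have : 2 * alpha k * (1 + gamma k) * gap Xs Ys (X k) <= M * gap Xs Ys (X k).
    rewrite ler_wpM2r// /M ler_pM// ?mulr_ge0 ?addr_ge0 ?(ltW (alpha_gt0 _))//.
    - by rewrite ltW// gamma_gt0.
    - by rewrite ler_wpM2l.
    - by rewrite lerD2l.
  have : frob_sq (Y k.+1 - Ys) / sigma k <= (sigma 0)^-1 * frob_sq (Y k.+1 - Ys).
    rewrite mulrC ler_wpM2r ?frob_sq_ge0// lef_pV2 ?posrE ?sigma_mono//.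
    by have /andP[] := sigma_bounds k.
  have := ler_wpM2l (ltW M0) (le_trans h2 (ler_wpM2l (ltW K0) h1)).
  by rewrite !mulrA; lra.
pose C := 1 + (sigma 0)^-1 + 1 + M * K * 4.
have C0 : 0 < C.
  have := mulr_gt0 M0 K0; have : 0 < (sigma 0)^-1 by rewrite invr_gt0.
  by rewrite /C; lra.
(* The second entry compensates for the division by [sbar] of the dual distance in [energy_ge]. *)
pose del := Num.min eps (eps / sbar).
have del0 : 0 < del by rewrite lt_min eps0 divr_gt0.
have [N NP] := increments_small (divr_gt0 del0 C0).
have [n Nn nP] := clust _ N (divr_gt0 del0 C0).
exists n.+1 => -[//|k]; rewrite ltnS => nk.
have En : energy Xs Ys n < del.
  apply: le_lt_trans (energy_le n) _.
  have tC : del / C * C = del by rewrite divfK// gt_eqF.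
  rewrite -tC; have := NP n Nn; move: nP; move: (del / C) => t.
  have : 0 <= dX n := frob_sq_ge0 _; have : 0 <= dY n := frob_sq_ge0 _.
  have := frob_sq_ge0 (X n.+1 - Xs); have := frob_sq_ge0 (Y n.+1 - Ys).
  move: (frob_sq _) (frob_sq _) (dX n) (dY n) => x y a b y0 x0 b0 a0 xyt abt.
  have yt : (sigma 0)^-1 * y <= (sigma 0)^-1 * t.
    by rewrite ler_wpM2l ?invr_ge0 ?(ltW s0)//; lra.
  have xat : M * K * (2 * (x + a)) <= M * K * (4 * t).
    by rewrite ler_wpM2l ?mulr_ge0 ?(ltW M0) ?(ltW K0)//; lra.
  by rewrite /C; lra.
have := le_lt_trans (le_trans (energy_ge k kktP) (energy_mono kktP nk)) En.
rewrite /del lt_min => /andP[lt1 lt2].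
have x0 := frob_sq_ge0 (X k.+1 - Xs).
have y0 : 0 <= frob_sq (Y k.+1 - Ys) / sbar by rewrite divr_ge0 ?frob_sq_ge0 ?ltW.
split; first lra.
rewrite -(ltr_pM2r (_ : 0 < sbar^-1)) ?invr_gt0//; lra.
Qed.

(** * The ergodic rate *)

Lemma merit_ergodic Xs Ys k : kkt Xs Ys -> (0 < k)%N ->
  theta gamma k * (gap Xs Ys (ergodic_avg gamma X k) +
    frob_sq (L *m ergodic_avg gamma X k)) <=
  \sum_(0 <= t < k) gamma t * (gap Xs Ys (X t) + frob_sq (L *m X t)).
Proof.
move=> kktP k0; set A := ergodic_avg _ _ _.
have th0 : theta gamma k != 0.
  case: k k0 @A => // k _ _; rewrite gt_eqF// /theta big_nat_recr//=.
  rewrite ltr_wpDl ?gamma_gt0// sumr_ge0// => t _; exact: (ltW (gamma_gt0 t)).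
(* Jensen's inequality by a tangent: [H] is the slope at the average [A] of the convex merit
   function, and the weighted deviations from [A] sum to zero. *)
pose H := G A + L *m Ys + 2 *: (L *m (L *m A)).
have tangent B : gap Xs Ys A + frob_sq (L *m A) + frob_dot (B - A) H <=
    gap Xs Ys B + frob_sq (L *m B).
  have BE : B - Xs = (B - A) + (A - Xs) by rewrite subrKA.
  have : frob_sq (L *m B) = frob_sq (L *m A) +
      2 * frob_dot (B - A) (L *m (L *m A)) + frob_sq (L *m (B - A)).
    have {1}-> : B = A + (B - A) by rewrite subrKC.
    by rewrite mulmxDr frob_sqD (frob_dotC (L *m A)) frob_dot_adjoint.
  have := frob_sq_ge0 (L *m (B - A)); have := grad_ineq A B.
  rewrite /gap BE (frob_dotDr (L *m Ys) (B - A)) /H !(frob_dotDr (B - A)) frob_dotZr.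
  by rewrite !(frob_dotC _ (B - A)); lra.
have centered : \sum_(0 <= t < k) gamma t *: (X t - A) = 0.
  under eq_bigr do rewrite scalerBr.
  rewrite sumrB -scaler_suml -/(theta gamma k) /A /ergodic_avg scalerA divff//.
  by rewrite scale1r subrr.
rewrite {1}/theta mulr_suml.
have := frob_dot0l H; rewrite -centered frob_dot_suml => sum0.
rewrite -[leLHS]addr0 -[X in _ + X <= _]sum0 -big_split /=; apply: ler_sum => t _.
by rewrite frob_dotZl -mulrDr ler_pM2l ?gamma_gt0.
Qed.

Lemma merit_ergodic_rate Xs Ys : kkt Xs Ys -> c2 < 1 ->
  exists2 C, 0 < C & forall k, (0 < k)%N ->
    gap Xs Ys (ergodic_avg gamma X k) + frob_sq (L *m ergodic_avg gamma X k) <=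
    C / k%:R.
Proof.
move=> kktP c21.
have [amin [amax [amin0 amax0 aP]]] := alpha_bounded.
have [gmin [gmax [gmin0 gmax0 gP]]] := gamma_bounded.
have [C1 C10 C1P] := consensus_residual.
have [C2 C20 C2P] := increments_le.
pose E0 := energy Xs Ys 0.
pose u := 2 * (1 - c2) * amin.
have u0 : 0 < u by rewrite mulr_gt0// mulr_gt0// subr_gt0.
(* Because [c2 < 1], the third term of [decrease] controls the gap. *)
have gapP k : gamma k * gap Xs Ys (X k) <= u^-1 * decrease Xs Ys k.
  rewrite ler_pdivlMl//.
  have [c10 c11] := andP c1_bounds; have [s0 _] := andP (sigma_bounds k.+1).
  have : 0 <= (1 - c1) / sigma k.+1 * dY k.
    by rewrite mulr_ge0 ?frob_sq_ge0// divr_ge0 ?(ltW s0)// subr_ge0 ltW.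
  have : 0 <= sigma k.+1 * alpha k.+1 ^+ 2 / c1 * dX k.
    rewrite mulr_ge0 ?frob_sq_ge0// divr_ge0 ?(ltW c10)//.
    by rewrite mulr_ge0 ?sqr_ge0// ltW.
  have /andP[a1 _] := aP k.
  have := ler_wpM2r (mulr_ge0 (ltW (gamma_gt0 k)) (gap_ge0 (X k) kktP)) a1.
  move/(ler_wpM2l (_ : 0 <= 2 * (1 - c2))); rewrite mulr_ge0 ?subr_ge0 ?(ltW c21)//.
  by move=> /(_ isT); rewrite /decrease /u; lra.
have resP k : gamma k.+1 * frob_sq (L *m X k.+1) <= gmax * C1 * C2 * decrease Xs Ys k.
  have /andP[_ g2] := gP k.+1.
  rewrite -!mulrA ler_pM ?frob_sq_ge0 ?(ltW (gamma_gt0 _))//.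
  by apply: le_trans (C1P k) _; rewrite ler_pM2l// C2P.
(* The middle term is the consensus error at index 0, which [consensus_residual] does not reach; its
   weight [gamma 0] is 1. *)
pose S := u^-1 * E0 + frob_sq (L *m X 0) + gmax * C1 * C2 * E0.
have sumP k : \sum_(0 <= t < k) gamma t * (gap Xs Ys (X t) + frob_sq (L *m X t)) <= S.
  under eq_bigr do rewrite mulrDr.
  have E00 : 0 <= E0 by apply: le_trans (decrease_sum 0 kktP); rewrite big_nil.
  have gcc : 0 <= gmax * C1 * C2 by rewrite !mulr_ge0 ?ltW.
  rewrite big_split /= /S -addrA lerD//.
    rewrite (le_trans (ler_sum _ (fun t _ => gapP t)))// -mulr_sumr.
    by rewrite ler_pM2l ?invr_gt0// decrease_sum.
  case: k => [|k]; first by rewrite big_nil addr_ge0 ?frob_sq_ge0// mulr_ge0.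
  rewrite big_nat_recl// gamma0 mul1r lerD2l.
  rewrite (le_trans (ler_sum _ (fun t _ => resP t)))// -mulr_sumr.
  by rewrite ler_wpM2l// decrease_sum.
have S0 : 0 <= S by have := sumP 0; rewrite big_nil.
exists ((S + 1) / gmin); first by rewrite divr_gt0// ltr_wpDl.
move=> k k0; have kR : 0 < k%:R :> R by rewrite ltr0n.
have thk : gmin * k%:R <= theta gamma k.
  rewrite mulr_natr -[k in gmin *+ k]subn0 -sumr_const_nat; apply: ler_sum => t _.
  by have /andP[] := gP t.
have := le_trans (merit_ergodic kktP k0) (sumP k).
set Q := _ + _ => thQ.
have Q0 : 0 <= Q by rewrite addr_ge0 ?gap_ge0 ?frob_sq_ge0.
rewrite ler_pdivlMr// ler_pdivlMr//.
have := ler_wpM2r Q0 thk; lra.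
Qed.

Lemma primal_dual_convergence :
  (exists B, forall k, frob_sq (X k) <= B) /\
  exists Xs Ys, [/\ kkt Xs Ys,
    forall eps, 0 < eps -> exists N, forall n, (N <= n)%N ->
      frob_sq (X n - Xs) < eps /\ frob_sq (Y n - Ys) < eps &
    c2 < 1 -> exists2 C, 0 < C & forall k, (0 < k)%N ->
      gap Xs Ys (ergodic_avg gamma X k) +
      frob_sq (L *m ergodic_avg gamma X k) <= C / k%:R].
Proof.
split; first by have [B [XB _]] := iterates_bounded; exists B.
have [Xs [Ys [kktP cvgP]]] := iterates_converge.
by exists Xs, Ys; split => // c21; exact: merit_ergodic_rate.
Qed.

End AdaptivePrimalDual.

(** * Application to ADOLF *)

Section LocalLipschitz.
Context {R : realType} {m d : nat}.
Variables (f : 'I_m -> 'rV[R]_d -> R) (X Z : 'M[R]_(m, d)).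

Lemma local_lip_ge0 : 0 <= local_lip f X Z.
Proof. by rewrite /local_lip; case: ifP => // _; rewrite divr_ge0 ?frob_norm_ge0. Qed.

Lemma local_lipE :
  frob_norm (gradF f X - gradF f Z) = local_lip f X Z * frob_norm (X - Z).
Proof.
rewrite /local_lip; case: eqVneq => [->|XZ].
  by rewrite mul0r subrr /frob_norm frob_dot0l sqrtr0.
rewrite divfK//; apply: contra_neq XZ => XZ0.
by apply/subr0_eq/frob_sq_le0; rewrite -frob_normE XZ0 expr0n.
Qed.

Lemma local_lip_least K : 0 <= K ->
  frob_norm (gradF f X - gradF f Z) <= K * frob_norm (X - Z) ->
  local_lip f X Z <= K.
Proof.
move=> K0; rewrite local_lipE; have [/eqP|n0] := eqVneq (frob_norm (X - Z)) 0.
  rewrite -sqrf_eq0 frob_normE => /eqP XZ _.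
  have /subr0_eq -> : X - Z = 0 by apply: frob_sq_le0; rewrite XZ.
  by rewrite /local_lip eqxx.
by rewrite ler_pM2r// lt_neqAle eq_sym n0 frob_norm_ge0.
Qed.

End LocalLipschitz.

(** Since [L Xs = 0], the Lagrangian at [Xs] does not depend on the dual variable; in the primal
    variable, the gradient inequality at [Xs] applies after moving [L] across the inner product. *)
Lemma saddle_point_kkt {R : realType} (m d : nat) (f : 'I_m -> 'rV[R]_d -> R)
    (L : 'M[R]_m) (Xs Ys : 'M[R]_(m, d)) :
  (forall A B : 'M[R]_(m, d),
    sumF f A + frob_dot (gradF f A) (B - A) <= sumF f B) ->
  L^T = L -> kkt (gradF f) L Xs Ys -> saddle_point (lagrangian f L) Xs Ys.
Proof.
move=> grad_ineq LT [LXs /eqP]; rewrite addrC addr_eq0 => /eqP LYs X Y.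
rewrite /lagrangian LXs !frob_dot0l; split => //.
have := grad_ineq Xs X.
rewrite -[gradF f Xs]opprK -LYs frob_dotNl frob_dotBr addr0.
rewrite (frob_dotC _ Xs) -(frob_dot_adjoint _ _ LT) LXs frob_dot0l.
by rewrite (frob_dotC _ X) -(frob_dot_adjoint _ _ LT); lra.
Qed.

(** Copies of a minimizer are stacked. Their gradients sum to zero, so [- gradF f Xs] has zero
    column sums and lies in the range of [L]. *)
Lemma kkt_consensus_min {R : realType} (m d : nat) (f : 'I_m -> 'rV[R]_d -> R)
    (e : rel 'I_m) (Wt L : 'M[R]_m) (c : R) xmin :
  (forall i, continuously_differentiable (f i)) ->
  (forall x, avg_objective f xmin <= avg_objective f x) -> (0 < m)%N ->
  undirected_connected e -> gossip_matrix e Wt -> 0 < c < 1 / 2 ->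
  L^T = L -> L *m L = c *: (1%:M - Wt) ->
  exists Ys, kkt (gradF f) L (\matrix_(i < m) xmin) Ys.
Proof.
move=> fC1 fmin m0 conn gossip c_bounds LT LL; set Xs := \matrix_(i < m) xmin.
have rowXs i : row i Xs = xmin by rewrite rowK.
have gradsum : \sum_i grad (f i) xmin = 0.
  apply: grad_sum_min => [i|x]; first by case: (fC1 i).
  by have := fmin x; rewrite /avg_objective ler_pM2l// invr_gt0 ltr0n.
have [Ys LYs] : exists Ys, L *m Ys = - gradF f Xs.
  apply: (gossip_sqrt_range conn gossip c_bounds LT LL) => j.
  have gradXs i : (- gradF f Xs) i j = - grad (f i) xmin 0 j.
    by rewrite mxE; congr (- _); rewrite /gradF mxE rowXs.
  under eq_bigr do rewrite gradXs.
  have /rowP/(_ j) := gradsum; rewrite summxE [RHS]mxE => sum0.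
  by rewrite sumrN sum0 oppr0.
exists Ys; split; last by rewrite LYs subrr.
by apply/(gossip_sqrt_ker conn gossip c_bounds LT LL) => i j; rewrite !rowXs.
Qed.

Theorem theorem1 (R : realType) (m d : nat) (hm : (0 < m)%N) (hd : (0 < d)%N)
  (f : 'I_m -> 'rV[R]_d -> R)
  (f_C1 : forall i, continuously_differentiable (f i))
  (f_smooth : forall i, locally_smooth (f i))
  (f_convex : forall i, convex_on_space (f i))
  (f_min : exists xmin, forall x, avg_objective f xmin <= avg_objective f x)
  (e : rel 'I_m) (e_conn : undirected_connected e)
  (Wt : 'M[R]_m) (Wt_gossip : gossip_matrix e Wt)
  (c : R) (c_bounds : 0 < c < 1 / 2)
  (W : 'M[R]_m) (W_def : W = (1 - c)%:M + c *: Wt)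
  (L : 'M[R]_m) (L_def : is_psd_sqrt (1%:M - W) L)
  (c1 c2 : R) (c1_bounds : 0 < c1 < 1) (c2_bounds : 0 < c2 <= 1)
  (sigma : nat -> R) (sigma_bar : R)
  (sigma_mono : forall j k : nat, (j <= k)%N -> sigma j <= sigma k)
  (sigma_bounds : forall k, 0 < sigma k <= sigma_bar)
  (pi : nat -> R -> R) (pi_ge : forall k x, 0 <= x -> x <= pi k x)
  (Xm1 : 'M[R]_(m, d)) (X D Y : nat -> 'M[R]_(m, d)) (alpha gamma : nat -> R)
  (run : adolf_run f W c1 c2 sigma pi Xm1 X D alpha gamma)
  (Y_def : auxiliary_dual L sigma alpha gamma Xm1 X Y) :
  exists Xs Ys : 'M[R]_(m, d),
    [/\ saddle_point (lagrangian f L) Xs Ys,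
        X @ \oo --> Xs,
        Y @ \oo --> Ys,
        D @ \oo --> L *m Ys
      & c2 < 1 ->
        (exists2 Lt : R, 0 < Lt &
           frob_lipschitz Lt (trajectory_hull Xm1 X) (gradF f)) /\
        forall Lt : R, 0 < Lt ->
          frob_lipschitz Lt (trajectory_hull Xm1 X) (gradF f) ->
          exists2 C : R, 0 < C &
            forall (eps : R) (k : nat), 0 < eps -> (1 <= k)%N ->
              C * Lt / eps <= k%:R ->
              merit f L Xs Ys (ergodic_avg gamma X k) <= eps].
Proof.
have [LT _ LL'] := L_def.
have LL : L *m L = c *: (1%:M - Wt).
  rewrite LL' W_def scalerBr scalemx1 opprD addrA.
  by rewrite -(raddfB (@scalar_mx R m)) subKr.
have [al0 ga0 D0 alS gaS DS XS] := run; have [Y0 YS] := Y_def.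
(* As [1 - W] is [L L], this identity turns ADOLF into the primal-dual iteration studied above. *)
have DL k : D k = L *m Y k.
  elim: k => [|k IH]; first by rewrite D0 Y0 mulmx0.
  rewrite DS YS IH (mulmxDr L) -(scalemxAr _ L); congr (_ + _ *: _).
  by rewrite -LL' -mulmxA !mulmxBr -!scalemxAr.
have [c10 c11] := andP c1_bounds; have [c20 c21] := andP c2_bounds.
pose l k := local_lip f (X k.+1) (X k).
have sig0 k : 0 < sigma k by have /andP[] := sigma_bounds k.
(* Joint induction: positivity of a stepsize uses both the previous stepsize and the previous
   ratio. *)
have alga k : 0 < alpha k /\ 0 < gamma k.
  elim: k => [|k [ak gk]]; first by rewrite al0 ga0.
  have [a0 _ _ _] := stepsize_bounds c10 c20 (local_lip_ge0 f (X k.+1) (X k))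
    (sig0 k.+1) gk ak (pi_ge k.+1 _ (ltW ak)).
  by rewrite gaS alS divr_gt0.
have stepP k := stepsize_bounds c10 c20 (local_lip_ge0 f (X k.+1) (X k))
    (sig0 k.+1) (alga k).2 (alga k).1 (pi_ge k.+1 _ (ltW (alga k).1)).
have grad_ineq (A B : 'M[R]_(m, d)) :
    sumF f A + frob_dot (gradF f A) (B - A) <= sumF f B.
  exact: sumF_grad_ineq.
have [xmin fmin] := f_min.
have [Y1 kktP1] := kkt_consensus_min f_C1 fmin hm e_conn Wt_gossip c_bounds LT LL.
have l_lip k :
    frob_sq (gradF f (X k.+1) - gradF f (X k)) <= l k ^+ 2 * frob_sq (X k.+1 - X k).
  by rewrite -!frob_normE -exprMn local_lipE.
have step_small k : 2 * alpha k.+1 * l k + 2 * sigma k.+1 * alpha k.+1 ^+ 2 / c1 <= 1.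
  by rewrite alS; have [] := stepP k.
have step_growth k : alpha k.+1 ^+ 2 <= (1 + c2 * gamma k) * alpha k ^+ 2.
  by rewrite alS; have [] := stepP k.
have step_lower k K : l k <= K ->
    Num.min (Num.sqrt (K ^+ 2 + 2 * sigma_bar / c1) + K)^-1 (alpha k) <= alpha k.+1.
  move=> lK; have [_ _ _ lower] := stepP k; rewrite alS.
  by apply: lower => //; have /andP[] := sigma_bounds k.+1.
have X_rec k : X k.+1 = X k - alpha k *: (gradF f (X k) + L *m Y k.+1).
  by rewrite XS DL.
have [[B XB] [Xs [Ys [kktP cvgP rate]]]] :=
  primal_dual_convergence grad_ineq
    (fun B => gradF_lipschitz_ball B f_C1 f_smooth) LT
    (gossip_sqrt_contract Wt_gossip c_bounds LT LL (d := d))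
    c1_bounds c2_bounds sigma_mono sigma_bounds (fun k => (alga k).1) ga0 gaS
    (fun k => local_lip_ge0 _ _ _) l_lip (fun k => @local_lip_least _ _ _ _ _ _)
    step_small step_growth step_lower X_rec (fun k => YS k.+1)
    (ex_intro _ _ (ex_intro _ _ kktP1)).
exists Xs, Ys; split.
- exact: saddle_point_kkt.
- by apply: frob_sq_cvg => eps /cvgP[N NP]; exists N => n /NP[].
- by apply: frob_sq_cvg => eps /cvgP[N NP]; exists N => n /NP[].
- apply: frob_sq_cvg => eps /cvgP[N NP]; exists N => n /NP[_].
  apply: le_lt_trans; rewrite DL -mulmxBr.
  exact: (gossip_sqrt_contract Wt_gossip c_bounds LT LL).
move=> c2lt1; split.
  (* The hull also contains the starting point [Xm1], which the bound on the iterates does not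
     cover. *)
  pose B' := B + frob_sq Xm1.
  have [K K0 KP] := gradF_lipschitz_ball B' f_C1 f_smooth.
  exists K => // A A' hA hA'.
  have B0 := le_trans (frob_sq_ge0 _) (XB 0%N).
  have hull : trajectory_hull Xm1 X `<=` [set Z | frob_sq Z <= B'].
    apply: trajectory_hull_sub => [|k]; first by rewrite lerDr.
    by apply: le_trans (XB k) _; rewrite lerDl frob_sq_ge0.
  by apply: KP; exact: hull.
move=> Lt Lt0 _; have [C C0 CP] := rate c2lt1.
(* With this witness the threshold [C * Lt / eps] becomes the rate constant over [eps]; it depends
   on [Lt] but not on [eps] or [k]. *)
exists (C / Lt) => [|eps k eps0 k0]; first by rewrite divr_gt0.
rewrite divfK ?gt_eqF// ler_pdivrMr// => Ck.
have kR : 0 < k%:R :> R by rewrite ltr0n.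
rewrite /merit frob_normE; apply: le_trans (CP k k0) _.
by rewrite ler_pdivrMr// mulrC.
Qed.
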